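(* Let $f:M\to M$ be an Axiom A diffeomorphism of a compact Riemannian manifold. Then the nonwandering set admits a unique decomposition $\Omega(f)=\Omega_1\cup\Omega_2\cup\cdots\cup\Omega_s$, where the $\Omega_i$ are pairwise disjoint, closed, $f$-invariant sets satisfying: (a) $f|_{\Omega_i}$ is topologically transitive for each $i$. (b) Each $\Omega_i$ admits a further decomposition $\Omega_i=X_{1,i}\cup\cdots\cup X_{n_i,i}$ where the $X_{j,i}$ are pairwise disjoint closed sets with $f(X_{j,i})=X_{j+1,i}$ (first indices taken mod $n_i$), and $f^{n_i}|_{X_{j,i}}$ is topologically mixing for each $j$.
   Context: A point $x\in M$ is nonwandering for $f$ if for every neighborhood $U$ of $x$ and every $N>0$ there is $n>N$ with $f^n(U)\cap U\ne\emptyset$; $\Omega(f)$ is the set of nonwandering points. A compact $f$-invariant set $\Lambda$ is hyperbolic if there is a continuous $Df$-invariant splitting $T_\Lambda M=E^s\oplus E^u$ and constants $c>0,\lambda\in(0,1)$ with $\|Df^n_xv\|\le c\lambda^n\|v\|$ for $v\in E^s_x$ and $\|Df^{-n}_xv\|\le c\lambda^n\|v\|$ for $v\in E^u_x$, for all $x\in\Lambda$, $n\ge0$. A $C^r$ diffeomorphism ($r\ge1$) $f$ satisfies Axiom A if $\Omega(f)$ is hyperbolic and the periodic points of $f$ are dense in $\Omega(f)$. A homeomorphism $g:X\to X$ of a compact metric space is topologically transitive if for all nonempty open $U,V\subset X$ there is $n>0$ with $g^n(U)\cap V\neq\emptyset$; it is topologically mixing if for all nonempty open $U,V$ there is $N>0$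 with $g^n(U)\cap V\ne\emptyset$ for all $n\ge N$. *)

(* Defs.v *)
From HB Require Import structures.
From mathcomp Require Import all_boot all_order all_algebra.
From mathcomp Require Import all_classical all_reals all_analysis.
Import numFieldNormedType.Exports.

Set Implicit Arguments.
Unset Strict Implicit.
Unset Printing Implicit Defensive.

Local Open Scope classical_set_scope.
Local Open Scope ring_scope.

(* C^k on an open set U: h is (Frechet) differentiable on U and all its
   directional derivatives are C^(k-1) there. *)
Fixpoint Ck_on (R : realType) (V W : normedModType R) (k : nat) (U : set V)
    (h : V -> W) : Prop :=
  match k with
  | 0 => forall x, U x -> {for x, continuous h}
  | k'.+1 => (forall x, U x -> differentiable h x) /\
             forall v, Ck_on k' U (fun x => 'd h x v)
  end.

Definition smooth_on (R : realType) (V W : normedModType R) (U : set V)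
    (h : V -> W) : Prop :=
  forall k, Ck_on k U h.

(* A C^oo manifold without boundary, of dimension d. The field [chart_at]
   expresses that the charts cover M, by selecting one chart around each point.
   Second countability is not required, as it follows from compactness. *)
Record manifold (R : realType) (d : nat) := Manifold {
  points :> topologicalType ;
  chart_index : Type ;
  chart_dom : chart_index -> set points ;
  chart : chart_index -> points -> 'rV[R]_d ;
  chart_inv : chart_index -> 'rV[R]_d -> points ;
  chart_at : points -> chart_index ;
  points_hausdorff : hausdorff_space points ;
  chart_dom_open : forall i, open (chart_dom i) ;
  chart_cod_open : forall i, open (chart i @` chart_dom i) ;
  chartK : forall i x, chart_dom i x -> chart_inv i (chart i x) = x ;
  chart_continuous : forall i, {within chart_dom i, continuous (chart i)} ;
  chart_inv_continuous : forall i,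
    {within chart i @` chart_dom i, continuous (chart_inv i)} ;
  chart_at_dom : forall x, chart_dom (chart_at x) x ;
  chart_smooth : forall i j,
    smooth_on (chart i @` (chart_dom i `&` chart_dom j))
              (chart j \o chart_inv i)
}.

(* The tangent space T_x M is identified with R^d by means of the coordinates
   given by the chart [chart_at x]. *)
Definition tangent (R : realType) (d : nat) (M : manifold R d) (x : M) : Type :=
  'rV[R]_d.

Definition tangent_map (R : realType) (d : nat) (M : manifold R d)
    (h : M -> M) (x : M) (v : tangent x) : tangent (h x) :=
  'd (chart (chart_at (h x)) \o h \o chart_inv (chart_at x))
     (chart (chart_at x) x) v.

(* Passage between T_x M and the coordinates given by any chart i around x. *)
Definition to_chart (R : realType) (d : nat) (M : manifold R d)
    (i : chart_index M) (x : M) (v : tangent x) : 'rV[R]_d :=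
  'd (chart i \o chart_inv (chart_at x)) (chart (chart_at x) x) v.

Definition of_chart (R : realType) (d : nat) (M : manifold R d)
    (i : chart_index M) (x : M) (u : 'rV[R]_d) : tangent x :=
  'd (chart (chart_at x) \o chart_inv i) (chart i x) u.

Definition mx_inner (R : realType) (d : nat) (G : 'M[R]_d) (u v : 'rV[R]_d) : R :=
  (u *m G *m v^T) ord0 ord0.

(* [metric_mx x] is the Gram matrix of the inner product of T_x M in the
   coordinates of [chart_at x]. *)
Record riemannian_metric (R : realType) (d : nat) (M : manifold R d) :=
  RiemannianMetric {
    metric_mx : M -> 'M[R]_d ;
    metric_sym : forall x, (metric_mx x)^T = metric_mx x ;
    metric_pos : forall x (v : 'rV[R]_d), v != 0 -> 0 < mx_inner (metric_mx x) v v ;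
    metric_smooth : forall i (u v : 'rV[R]_d),
      smooth_on (chart i @` chart_dom i)
        (fun p => let x := chart_inv i p in
           mx_inner (metric_mx x) (of_chart i x u) (of_chart i x v))
  }.

Definition tnorm (R : realType) (d : nat) (M : manifold R d)
    (g : riemannian_metric M) (x : M) (v : tangent x) : R :=
  Num.sqrt (mx_inner (metric_mx g x) v v).

Definition Cr_map (R : realType) (d : nat) (M : manifold R d) (r : nat)
    (h : M -> M) : Prop :=
  continuous h /\
  forall i j : chart_index M,
    Ck_on r (chart i @` (chart_dom i `&` h @^-1` chart_dom j))
            (chart j \o h \o chart_inv i).

Definition Cr_diffeo (R : realType) (d : nat) (M : manifold R d) (r : nat)
    (f finv : M -> M) : Prop :=
  [/\ cancel f finv, cancel finv f, Cr_map r f & Cr_map r finv].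

Definition nonwandering (M : topologicalType) (f : M -> M) : set M :=
  [set x | forall U, nbhs x U -> forall N : nat, (0 < N)%N ->
     exists2 n, (N < n)%N & (iter n f @` U) `&` U !=set0].

Definition periodic (M : Type) (f : M -> M) : set M :=
  [set x | exists2 n, (0 < n)%N & iter n f x = x].

(* A family of subspaces E_x of T_x M, for x in L, is continuous when it is
   spanned, near each point of L, by a frame of continuous vector fields. *)
Definition continuous_subbundle (R : realType) (d : nat) (M : manifold R d)
    (L : set M) (E : M -> {vspace 'rV[R]_d}) : Prop :=
  forall x, L x ->
  exists (W : set M) (k : nat) (X : 'I_k -> forall y : M, tangent y),
    [/\ open W, W x, W `<=` chart_dom (chart_at x),
        forall a, {within L `&` W,
                   continuous (fun y => to_chart (chart_at x) (X a y))}
      & forall y, L y -> W y -> basis_of (E y) [seq (X a y : 'rV[R]_d) | a : 'I_k]].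

Definition invariant_subbundle (R : realType) (d : nat) (M : manifold R d)
    (f : M -> M) (L : set M) (E : M -> {vspace 'rV[R]_d}) : Prop :=
  forall x, L x ->
    @tangent_map R d M f x @` [set v | v \in E x] = [set v | v \in E (f x)].

Definition hyperbolic (R : realType) (d : nat) (M : manifold R d)
    (g : riemannian_metric M) (f finv : M -> M) (L : set M) : Prop :=
  [/\ compact L, f @` L = L &
  exists (Es Eu : M -> {vspace 'rV[R]_d}),
    [/\ forall x, L x ->
          (Es x + Eu x)%VS = fullv /\ (Es x :&: Eu x)%VS = 0%VS,
        continuous_subbundle L Es /\ continuous_subbundle L Eu,
        invariant_subbundle f L Es /\ invariant_subbundle f L Eu &
    exists c lambda : R,
      [/\ 0 < c, 0 < lambda < 1,
          forall x n (v : tangent x), L x -> v \in Es x ->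
            tnorm g (tangent_map (iter n f) v) <= c * lambda ^+ n * tnorm g v &
          forall x n (v : tangent x), L x -> v \in Eu x ->
            tnorm g (tangent_map (iter n finv) v) <= c * lambda ^+ n * tnorm g v]]].

Definition axiomA (R : realType) (d : nat) (M : manifold R d)
    (g : riemannian_metric M) (f finv : M -> M) : Prop :=
  hyperbolic g f finv (nonwandering f) /\
  nonwandering f `<=` closure (periodic f).

(* Transitivity and mixing of the restriction of h to an invariant set X; the
   open sets of X are the sets X `&` U with U open. *)
Definition transitive_on (M : topologicalType) (h : M -> M) (X : set M) : Prop :=
  forall U V, open U -> open V -> X `&` U !=set0 -> X `&` V !=set0 ->
    exists2 n, (0 < n)%N & (iter n h @` (X `&` U)) `&` (X `&` V) !=set0.

Definition mixing_on (M : topologicalType) (h : M -> M) (X : set M) : Prop :=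
  forall U V, open U -> open V -> X `&` U !=set0 -> X `&` V !=set0 ->
    exists2 N, (0 < N)%N & forall n, (N <= n)%N ->
      (iter n h @` (X `&` U)) `&` (X `&` V) !=set0.

Definition mixing_decomposition (M : topologicalType) (f : M -> M) (Y : set M)
    (n : nat) (X : 'I_n -> set M) : Prop :=
  [/\ \bigcup_j X j = Y,
      trivIset setT X,
      forall j, closed (X j),
      forall j, f @` X j = X (ordS j) &
      forall j, mixing_on (iter n f) (X j)].

(* The pieces are required to be nonempty: otherwise uniqueness fails, as one
   may add the empty set to the list. *)
Definition spectral_decomposition (M : topologicalType) (f : M -> M)
    (s : nat) (Om : 'I_s -> set M) : Prop :=
  [/\ \bigcup_i Om i = nonwandering f,
      trivIset setT Om,
      forall i, [/\ Om i !=set0, closed (Om i) & f @` Om i = Om i],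
      forall i, transitive_on f (Om i) &
      forall i, exists n (X : 'I_n -> set M),
        (0 < n)%N /\ mixing_decomposition f (Om i) X].

(* Main.v *)
From HB Require Import structures.
From mathcomp Require Import finmap.
From mathcomp Require Import all_boot all_order all_algebra.
From mathcomp Require Import all_classical all_reals all_analysis.
From mathcomp Require Import ring lra.
Require Import Defs.
Import Order.TTheory GRing.Theory Num.Theory.
Import numFieldNormedType.Exports.

(** The proof rests on two properties of the hyperbolic set [Om] of nonwandering
    points: fine periodic pseudo-orbits in [Om] are shadowed by periodic orbits
    ([hyperbolic_shadowing]), and orbits in [Om] that stay close to each other over
    a long window are very close in its middle ([hyperbolic_expansive]).  Closeness
    is expressed by neighbourhoods of the diagonal.

    Both properties come from one estimate, [hyperbolic_window].  Along an orbit in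
    [Om], consider vectors that follow the differential of [f] up to errors.  Over
    a long window [0, 2m] the vector at time [m] is dominated by those at times [0]
    and [2m] and by the errors: its stable part has been strongly contracted since
    time [0], and its unstable part is strongly expanded until time [2m].
    Compactness makes all constants uniform in finitely many charts, and the
    estimate extends to fine pseudo-orbits, which follow true orbits over windows
    of fixed length ([pseudo_orbit_estimate]).  For the difference of two close
    orbits, the estimate gives a geometric decay towards the centre of the window,
    which is expansivity.  For shadowing, the sought periodic orbit solves an almost
    linear equation on the finite-dimensional space of periodic sequences; the
    estimate says that the linear part is bounded from below, hence invertible with
    a bound independent of the period, and the contraction principle applies
    ([periodic_recursion_solution]).

    The decomposition is then obtained from chains.  Call two points of [Om]
    equivalent when fine pseudo-orbits in [Om] join them both ways.  Since periodic
    points are dense, every point is equivalent to itself; if two periodic points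
    are close, a pseudo-orbit that follows the one for long, then the other, is
    shadowed by an orbit that expansivity brings arbitrarily near to both, so they
    are equivalent ([close_periodic_link]).  Hence the classes are open in the
    compact set [Om], so they are finite in number, and shadowing turns chains into
    orbits, which gives transitivity.  The lengths of the closed chains in a class
    have a period [n] ([class_period]), and the lengths modulo [n] of the chains from
    a base point split the class into [n] pieces, on which the [n]-th iterate is
    mixing, because all large multiples of [n] are lengths of chains
    ([class_mixing_decomposition]).

    Uniqueness holds for any such decompositions: the pieces are open, closed and
    invariant in [Om], so a transitive piece of the one lies in a piece of the
    other ([spectral_decomposition_sub]). *)

Set Implicit Arguments.
Unset Strict Implicit.
Unset Printing Implicit Defensive.

Local Open Scope classical_set_scope.

(** * Neighbourhoods of the diagonal *)

(** The finite sets of points of [K], ordered by inclusion, define a filter along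
    which near-covering compactness yields the finite subcover. *)
Lemma compact_finite_nbhs (T : topologicalType) (K : set T) (W : T -> set T) :
  compact K -> (forall x, K x -> nbhs x (W x)) ->
  exists s : seq T, (forall x, x \in s -> K x) /\
    forall y, K y -> exists2 x, x \in s & W x y.
Proof.
move=> /compact_near_coveringP/near_covering_withinP cK nW.
pose inK (s : seq T) := forall x, x \in s -> K x.
pose F : set_system (seq T) := [set P | exists s0, inK s0 /\
  forall s, inK s -> {subset s0 <= s} -> P s].
have FF : Filter F.
  split=> [|P Q [s [Ks sP]] [t [Kt tQ]]|P Q PQ [s [Ks sP]]].
  - by exists [::].
  - exists (s ++ t); split=> [x|u Ku stu].
      by rewrite mem_cat => /orP[/Ks|/Kt].
    split; [apply: sP => // x xs|apply: tQ => // x xt]; apply: stu.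
      by rewrite mem_cat xs.
    by rewrite mem_cat xt orbT.
  - by exists s; split => // t Kt st; exact/PQ/sP.
have [] := cK (seq T) F (fun s y => exists2 x, x \in s & W x y) FF.
  move=> x Kx; exists (W x, [set s : seq T | x \in s]) => /=; first split; first exact: nW.
    exists [:: x]; split=> [y|s _]; first by rewrite inE => /eqP ->.
    by move=> /(_ x); rewrite inE eqxx; exact.
  by move=> [y s] /= [Wy xs] _; exists x.
by move=> s [Ks sH]; exists s; split => // y; exact: (sH s Ks).
Qed.

(** In a compact Hausdorff space these are the entourages of the only compatible
    uniformity; they play the role of a distance. *)
Definition vicinity (M : topologicalType) (E : set (M * M)) : Prop :=
  forall x : M, nbhs (x, x) E.

Section Vicinities.
Variable M : topologicalType.
Implicit Types (D E : set (M * M)) (x y : M) (U V : set M).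

Lemma vicinity_refl E x : vicinity E -> E (x, x).
Proof. by move=> vE; exact: nbhs_singleton (vE x). Qed.

Lemma vicinityI D E : vicinity D -> vicinity E -> vicinity (D `&` E).
Proof. by move=> vD vE x; exact: filterI. Qed.

Lemma vicinityS D E : D `<=` E -> vicinity D -> vicinity E.
Proof. by move=> DE vD x; exact: filterS (vD x). Qed.

Lemma vicinity_forall (I : finType) (F : I -> set (M * M)) :
  (forall i, vicinity (F i)) -> vicinity [set ab | forall i, F i ab].
Proof.
move=> vF x; have := @filter_forall _ _ _ (nbhs (x, x)) _ (fun i => vF i x).
exact.
Qed.

Lemma vicinity_square E x : vicinity E ->
  exists U, [/\ open U, U x & forall a b, U a -> U b -> E (a, b)].
Proof.
move=> /(_ x) [[P Q] /= [nP nQ] PQE].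
pose U := (P `&` Q)^°; have UPQ : U `<=` P `&` Q by exact: interior_subset.
exists U; split; [exact: open_interior|exact: filterI|].
by move=> a b /UPQ[Pa _] /UPQ[_ Qb]; exact: PQE.
Qed.

Lemma square_vicinity E :
  (forall x, exists2 U, nbhs x U & forall a b, U a -> U b -> E (a, b)) ->
  vicinity E.
Proof.
move=> H x; have [U nU UE] := H x; exists (U, U); first by split.
by move=> [a b] [Ua Ub]; exact: UE.
Qed.

Lemma vicinity_swap E : vicinity E -> vicinity [set ab | E (ab.2, ab.1)].
Proof.
move=> vE; apply: square_vicinity => x; have [U [oU Ux UE]] := vicinity_square x vE.
by exists U => [|a b Ua Ub]; [exact: open_nbhs_nbhs|exact: UE].
Qed.

Lemma vicinity_preimage (h : M -> M) E : continuous h -> vicinity E ->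
  vicinity [set ab | E (h ab.1, h ab.2)].
Proof.
move=> ch vE; apply: square_vicinity => x.
have [U [oU Ux UE]] := vicinity_square (h x) vE.
by exists (h @^-1` U) => [|a b Ua Ub]; [exact/ch/open_nbhs_nbhs|exact: UE].
Qed.

(** Singles out one point: closeness for this vicinity to the point [x] itself
    means membership in the prescribed neighbourhood. *)
Lemma vicinity_at x U : hausdorff_space M -> nbhs x U ->
  vicinity [set ab | ab.1 = x -> U ab.2].
Proof.
move=> hM nU; apply: square_vicinity => y; have [->|yx] := pselect (y = x).
  by exists U => // a b _ Ub _.
exists (~` [set x]); last by move=> a b /= ax _ ex; exfalso; exact: ax.
apply: open_nbhs_nbhs; split => //; apply: closed_openC.
by apply: accessible_closed_set1; exact: hausdorff_accessible.
Qed.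

End Vicinities.

Section CompactVicinities.
Variable M : topologicalType.
Hypotheses (M_hausdorff : hausdorff_space M) (M_compact : compact [set: M]).
Implicit Types D E : set (M * M).

(** Lebesgue's number lemma: closed neighbourhoods inside the given ones, finitely
    many of which cover the space, leave room for a uniform margin. *)
Lemma vicinity_Lebesgue (W : M -> set M) : (forall p, nbhs p (W p)) ->
  exists2 D, vicinity D & forall x, exists p, forall y, D (x, y) -> W p y.
Proof.
move=> nW.
have shrink p : exists V, [/\ nbhs p V, closed V & V `<=` (W p)^°].
  have reg : {for p, regular_space M} by exact: (compact_regular M_hausdorff M_compact filterT).
  have nWi : nbhs p (W p)^° by exact: nbhs_interior.
  have [B nB BW] := reg _ nWi.
  exists (closure B); split; [|exact: closed_closure|exact: BW].
  exact: filterS (@subset_closure _ B) nB.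
have [V Vp] := choice shrink.
have [|s [_ sV]] := compact_finite_nbhs (W := V) M_compact.
  by move=> p _; have [] := Vp p.
exists [set ab | forall p, p \in s -> V p ab.1 -> W p ab.2].
  elim: s {sV} => [|p s IH]; first by move=> x; apply: filterE => -[a b] p /=; rewrite in_nil.
  have step : vicinity [set ab | V p ab.1 -> W p ab.2].
    have [_ clV VW] := Vp p; apply: square_vicinity => x.
    have [Vx|nVx] := pselect (V p x).
      exists (W p) => [|a b _ Wb _ //].
      by have := VW x Vx; rewrite /interior.
    exists (~` V p); last by move=> a b nVa _ /= /nVa.
    by apply: open_nbhs_nbhs; split => //; exact: closed_openC.
  apply: vicinityS (vicinityI step IH) => -[a b] /= [h1 h2] q.
  by rewrite inE => /orP[/eqP -> //|]; exact: h2.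
move=> x; have [p ps Vpx] := sV x I.
by exists p => y; exact.
Qed.

(** The triangle inequality of vicinities: [x] and [z] lie in one small set around
    [y], provided by the preceding lemma. *)
Lemma vicinity_half E : vicinity E ->
  exists2 D, vicinity D & forall x y z, D (x, y) -> D (y, z) -> E (x, z).
Proof.
move=> vE.
have [W WE] := choice (fun x => vicinity_square x vE).
have [|D vD DW] := @vicinity_Lebesgue W.
  by move=> p; have [oW Wp _] := WE p; exact: open_nbhs_nbhs.
exists (D `&` [set ab | D (ab.2, ab.1)]).
  by apply: vicinityI => //; exact: (vicinity_swap vD).
move=> x y z [_ /= yx] [yz _]; have [p pW] := DW y.
by have [_ _] := WE p; apply; exact: pW.
Qed.

(** Over a number [n] of steps fixed beforehand, fine pseudo-orbits stay close to
    the true orbit of their first point. *)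
Lemma vicinity_pseudo_orbit (f : M -> M) n E : continuous f -> vicinity E ->
  exists2 D, vicinity D & forall x : nat -> M,
    (forall i, (i < n)%N -> D (f (x i), x i.+1)) ->
    forall i, (i <= n)%N -> E (iter i f (x 0%N), x i).
Proof.
move=> cf; elim: n E => [|n IH] E vE.
  by exists E => // x _ i; rewrite leqn0 => /eqP ->; exact: vicinity_refl.
have [H vH HE] := vicinity_half vE.
have [D vD DH] := IH _ (vicinityI vE (vicinity_preimage cf vH)).
exists (D `&` H); first exact: vicinityI.
move=> x xD i; rewrite leq_eqVlt => /orP[/eqP ->|]; last first.
  rewrite ltnS => iln; have [] // := DH x _ i iln.
  by move=> k kn; have [] := xD k (ltnW kn).
have [_ h1] : (E `&` [set ab | H (f ab.1, f ab.2)]) (iter n f (x 0%N), x n).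
  by apply: DH => // k kn; have [] := xD k (ltnW kn).
by have [_ h2] := xD n (ltnSn n); exact: HE h1 h2.
Qed.

End CompactVicinities.

(** * Pseudo-orbits, shadowing and expansivity *)

(** The pseudo-orbits of Bowen and Conley, with their number [n] of steps, which
    is what the mixing of the pieces will depend on. *)
Fixpoint pchain (M : topologicalType) (f : M -> M) (Om : set M)
    (D : set (M * M)) (n : nat) (x y : M) : Prop :=
  if n is n'.+1 then exists z, [/\ Om z, D (f x, z) & pchain f Om D n' z y]
  else x = y.

(** Only periodic pseudo-orbits are to be shadowed, and by periodic orbits of the
    same length: such orbits are nonwandering, hence stay in [Om]. *)
Definition shadows (M : topologicalType) (f : M -> M) (Om : set M)
    (D E : set (M * M)) : Prop :=
  forall (n : nat) (x : nat -> M), (0 < n)%N -> (forall i, Om (x i)) ->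
    (forall i, x (i + n)%N = x i) -> (forall i, D (f (x i), x i.+1)) ->
    exists2 y, iter n f y = y & forall i, E (x i, iter i f y).

Definition shadowing (M : topologicalType) (f : M -> M) (Om : set M) : Prop :=
  forall E, vicinity E -> exists2 D, vicinity D & shadows f Om D E.

(** Expansivity in uniform form.  The window of times [-N, N] is translated to
    [0, 2N], so that only nonnegative iterates occur. *)
Definition expansive (M : topologicalType) (f : M -> M) (Om : set M) : Prop :=
  exists2 E0, vicinity E0 & forall E, vicinity E -> exists N : nat,
    forall x y, Om x -> Om y ->
      (forall i, (i <= N.*2)%N -> E0 (iter i f x, iter i f y)) ->
      E (iter N f x, iter N f y).

Section Chains.
Variables (M : topologicalType) (f : M -> M) (Om : set M).
Hypothesis Omf : forall x, Om x -> Om (f x).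
Implicit Types (D : set (M * M)).
Local Notation chain := (pchain f Om).

Lemma Om_iter n x : Om x -> Om (iter n f x).
Proof. by move=> Ox; elim: n => //= n; exact: Omf. Qed.

Lemma chain_cat D m n x y z : chain D m x y -> chain D n y z -> chain D (m + n) x z.
Proof.
elim: m x => [x ->//|m IH x [t [Ot Dt ty]] yz]; rewrite addSn /=.
by exists t; split => //; exact: IH.
Qed.

Lemma chain_sub D D' n x y : D `<=` D' -> chain D n x y -> chain D' n x y.
Proof.
move=> DD'; elim: n x => //= n IH x [z [Oz Dz zy]].
by exists z; split; [|exact: DD'|exact: IH].
Qed.

Lemma chain_orbit D n x : vicinity D -> Om x -> chain D n x (iter n f x).
Proof.
move=> vD; elim: n x => //= n IH x Ox; exists (f x); split; first exact: Omf.
  exact: vicinity_refl.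
by rewrite -iterS iterSr; apply/IH/Omf.
Qed.

Lemma chain_step D x y : Om y -> D (f x, y) -> chain D 1 x y.
Proof. by move=> Oy Dxy; exists y. Qed.

Lemma chain_seq D n x y : Om x -> chain D n x y ->
  exists s : nat -> M, [/\ s 0 = x, s n = y, forall i, (i <= n)%N -> Om (s i) &
    forall i, (i < n)%N -> D (f (s i), s i.+1)].
Proof.
elim: n x => /= [|n IH] x Ox; first by move=> <-; exists (fun=> x).
move=> [z [Oz Dz zy]]; have [s [s0 sn Os sD]] := IH z Oz zy.
exists (fun i => if i is j.+1 then s j else x); split => //.
  by case.
by case=> [_|i]; [rewrite s0|exact: sD].
Qed.

(** Two segments of pseudo-orbit, each starting where the other one ends, make up
    a periodic pseudo-orbit once they are run through in turn. *)
Lemma shadow_two_segments E D k l (s t : nat -> M) :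
  shadows f Om D E -> (0 < k + l)%N -> s k = t 0%N -> t l = s 0%N ->
  (forall i, (i <= k)%N -> Om (s i)) -> (forall i, (i <= l)%N -> Om (t i)) ->
  (forall i, (i < k)%N -> D (f (s i), s i.+1)) ->
  (forall i, (i < l)%N -> D (f (t i), t i.+1)) ->
  exists z, [/\ iter (k + l) f z = z, forall i, (i < k)%N -> E (s i, iter i f z) &
    forall i, (i < l)%N -> E (t i, iter (k + i) f z)].
Proof.
move=> sh kl0 skt tls Os Ot sD tD.
set n := (k + l)%N in kl0 *.
pose r i := if (i < k)%N then s i else t (i - k)%N.
have rn : r n = s 0 by rewrite /r /n ltnNge leq_addr /= addKn.
have r0 : r 0 = s 0.
  by rewrite /r; case: ltnP => //; rewrite leqn0 => /eqP k0; rewrite k0 subn0 -skt k0.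
have Or i : (i <= n)%N -> Om (r i).
  rewrite /r; case: ltnP => [/ltnW ik _|ki]; first exact: Os.
  by move=> ikl; apply: Ot; rewrite leq_subLR.
have rD i : (i < n)%N -> D (f (r i), r i.+1).
  rewrite /r => ikl; case: (ltnP i k) => ik.
    move: (ik); rewrite leq_eqVlt => /orP[/eqP ek|->]; last exact: sD.
    by rewrite ek ltnn subnn -skt -ek; apply: sD; rewrite -ek.
  by rewrite ltnNge leqW//= subSn//; apply: tD; rewrite ltn_subLR.
have [|||z zn zE] := sh n (fun i => r (i %% n)%N) kl0.
- by move=> i; apply: Or; rewrite ltnW// ltn_mod.
- by move=> i; rewrite modnDr.
- move=> i; have := rD (i %% n)%N; rewrite ltn_mod => /(_ kl0).
  rewrite -[in (i.+1 %% n)%N]addn1 -modnDml addn1.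
  have : (i %% n < n)%N by rewrite ltn_mod.
  rewrite leq_eqVlt => /orP[/eqP en|ltn]; last by rewrite (modn_small ltn).
  by rewrite en modnn r0 rn.
exists z; split => // i il; have := zE i; have := zE (k + i)%N.
  by move=> _; rewrite modn_small ?(leq_trans il) ?leq_addr// /r il.
by rewrite modn_small ?ltn_add2l// /r ltnNge leq_addr/= addKn.
Qed.

(** The case [k = 0] stands apart because the first segment, from which the
    closeness of [x] and [z] is read off, is then empty. *)
Lemma shadow_closed_chain E D k l x y :
  shadows f Om D E -> Om x -> (0 < l)%N -> chain D k x y -> chain D l y x ->
  exists z, [/\ iter (k + l) f z = z, k = 0%N \/ E (x, z) & E (y, iter k f z)].
Proof.
move=> sh Ox l0 xy yx.
have [s [s0 sk Os sD]] := chain_seq Ox xy.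
have Oy : Om y by rewrite -sk; exact: Os.
have [t [t0 tl Ot tD]] := chain_seq Oy yx.
have [|||z [zn zs zt]] := @shadow_two_segments E D k l s t sh _ _ _ Os Ot sD tD.
- by rewrite addn_gt0 l0 orbT.
- by rewrite sk t0.
- by rewrite tl s0.
exists z; split => //; last by have := zt 0%N l0; rewrite addn0 t0.
by case: (posnP k) => [->|/zs]; [left|rewrite s0; right].
Qed.

End Chains.

(** * Chain classes *)

(** A semigroup of integers consists, beyond some point, of all multiples of [d].
    Here [d] arises as the least positive difference of two elements [b] and
    [b + d], which gives both claims: combinations of the two reach every large
    multiple of [d], and a remainder modulo [d] would be a smaller difference. *)
Lemma semigroup_multiples (S : nat -> Prop) :
  (exists2 s, (0 < s)%N & S s) -> (forall a b, S a -> S b -> S (a + b)%N) ->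
  exists d, [/\ (0 < d)%N, forall s, S s -> (d %| s)%N &
    exists N, forall k, (N <= k)%N -> S (d * k)%N].
Proof.
move=> [s0 s00 Ss0] SD.
have SM a b q : S a -> S b -> S (a + q * b)%N.
  move=> Sa Sb; elim: q => [|q IH]; first by rewrite addn0.
  by rewrite mulSn addnCA addnC; apply: SD.
pose P m := `[< (0 < m)%N /\ exists a, S a /\ S (a + m)%N >].
have exP : exists m, P m.
  by exists s0; apply/asboolP; split => //; exists s0; split => //; exact: SD.
case: (ex_minnP exP) => d /asboolP[d0 [b [Sb Sbd]]] dmin.
have dS s : S s -> (d %| s)%N.
  move=> Ss; have [r0|r0] := posnP (s %% d)%N; first exact/eqP.
  have : P (s %% d)%N.
    apply/asboolP; split => //; exists (s + (s %/ d) * (b + d))%N.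
    split; first exact: SM.
    have -> : (s + (s %/ d) * (b + d) + s %% d = s + s + (s %/ d) * b)%N.
      by rewrite {4}(divn_eq s d); ring.
    by apply: SM => //; exact: SD.
  by move=> /dmin; rewrite leqNgt ltn_mod d0.
exists d; split => //.
pose c := (b + s0)%N.
have Sc : S c by exact: SD.
have Scd : S (c + d)%N by rewrite /c addnAC; exact: SD.
have c0 : (0 < c)%N by rewrite /c addn_gt0 s00 orbT.
have /dvdnP[t ct] := dS _ Sc.
have t0 : (0 < t)%N by move: c0; rewrite ct; case: t {ct}.
(* With [k = q t + r] and [c = d t], the multiple [d k] is [q - r] times [c] plus
   [r] times [c + d]; the bound [t * t] forces [r < q]. *)
exists (t * t)%N => k tk.
have tq : (t <= k %/ t)%N by rewrite leq_divRL.
have rt : (k %% t < t)%N by rewrite ltn_mod.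
have rq : (k %% t < k %/ t)%N by exact: leq_trans rt tq.
have -> : (d * k = c + (k %/ t - (k %% t).+1) * c + k %% t * (c + d))%N.
  have -> : (c + (k %/ t - (k %% t).+1) * c = (k %/ t - k %% t) * c)%N.
    by rewrite -mulSn -subSn// subSS.
  rewrite mulnDr addnA -mulnDl subnK ?(ltnW rq)//.
  by rewrite ct {1}(divn_eq k t); ring.
by apply: (SM) => //; exact: SM.
Qed.

Lemma iter_period (T : Type) (f : T -> T) k m p :
  iter k f p = p -> iter (m * k) f p = p.
Proof. by move=> kp; elim: m => //= m IH; rewrite mulSn iterD IH. Qed.

Section ChainClasses.
Variables (M : topologicalType) (f : M -> M) (Om : set M).
Hypotheses (M_hausdorff : hausdorff_space M) (f_cont : continuous f).
Hypotheses (Om_compact : compact Om) (f_Om : f @` Om = Om).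
Hypothesis periodic_Om : periodic f `<=` Om.
Hypothesis Om_periodic : Om `<=` closure (periodic f).
Hypotheses (f_shadowing : shadowing f Om) (f_expansive : expansive f Om).
Local Notation chain := (pchain f Om).

Let Omf x : Om x -> Om (f x).
Proof. by move=> Ox; rewrite -f_Om; exists x. Qed.

Let Om_closed : closed Om.
Proof. exact: compact_closed. Qed.

(** The points of [Om] near [x] are joined both ways with a periodic point [p] near
    [x], by chains whose length is a period of [p].  This is how the density of the
    periodic points enters, and why lengths of chains reflect periods. *)
Lemma chain_periodic D x V : vicinity D -> Om x -> nbhs x V ->
  exists p k W, [/\ [/\ (0 < k)%N, iter k f p = p, V p & Om p], nbhs x W, W `<=` V &
    forall y, W y -> Om y -> chain D k y p /\ chain D k p y].
Proof.
move=> vD Ox nV.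
have [U [oU Ux UD]] := vicinity_square x vD.
have [U' [oU' Ux' UD']] := vicinity_square (f x) vD.
pose W := V `&` (U `&` (f @^-1` U')).
have nW : nbhs x W.
  apply: filterI => //; apply: filterI; first exact: open_nbhs_nbhs.
  by apply: f_cont; exact: open_nbhs_nbhs.
have [p [[k k0 kp] [Vp [Up fp]]]] := Om_periodic Ox nW.
have Op : Om p by apply: periodic_Om; exists k.
exists p, k, W; split => // [y []//|y [_ [Uy fy]] Oy].
case: k k0 kp => // k _ kp; split.
  exists (f p); split; [exact: Omf|exact: UD'|].
  by have := chain_orbit Omf k vD (Omf Op); rewrite -iterSr kp.
rewrite -addn1; apply: chain_cat (chain_orbit Omf k vD Op) _.
by apply: chain_step => //; rewrite -iterS kp; exact: UD.
Qed.

Definition link x y := forall D, vicinity D -> exists n, chain D n.+1 x y.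

(** Conley's chain equivalence, for chains that stay in [Om]. *)
Definition chain_equiv x y := [/\ Om x, Om y, link x y & link y x].

Lemma link_trans x y z : link x y -> link y z -> link x z.
Proof.
move=> xy yz D vD; have [m cm] := xy D vD; have [n cn] := yz D vD.
by exists (m + n.+1)%N; rewrite -addSn; exact: chain_cat cm cn.
Qed.

Lemma link_refl x : Om x -> link x x.
Proof.
move=> Ox D vD; have [p [k [W [[k0 kp _ _] nW _ Wc]]]] := chain_periodic vD Ox filterT.
have [xp px] := Wc x (nbhs_singleton nW) Ox.
by exists (k + k).-1; rewrite prednK ?addn_gt0 ?k0//; exact: chain_cat xp px.
Qed.

Lemma chain_equiv_refl x : Om x -> chain_equiv x x.
Proof. by move=> Ox; split => //; exact: link_refl. Qed.

Lemma chain_equiv_sym x y : chain_equiv x y -> chain_equiv y x.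
Proof. by case. Qed.

Lemma chain_equiv_trans x y z : chain_equiv x y -> chain_equiv y z -> chain_equiv x z.
Proof.
by move=> [Ox Oy xy yx] [_ Oz yz zy]; split=> //; [exact: link_trans yz|exact: link_trans yx].
Qed.

(** To return from [f x] to [x], go over from [f x] to [f p], for a periodic point
    [p] close to [x], and then along the orbit of [p]. *)
Lemma chain_equiv_f x : Om x -> chain_equiv x (f x).
Proof.
move=> Ox; split => //; first exact: Omf.
  by move=> D vD; exists 0%N; exact: (chain_orbit Omf 1 vD Ox).
move=> D vD.
have [q [l [W' [[l0 _ _ _] nW' _ Wc']]]] := chain_periodic vD (Omf Ox) filterT.
have [p [k [W [[k0 kp Vp Op] nW _ Wc]]]] := chain_periodic vD Ox (f_cont nW').
have [fxq _] := Wc' (f x) (nbhs_singleton nW') (Omf Ox).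
have [_ qfp] := Wc' (f p) Vp (Omf Op).
have [_ px] := Wc x (nbhs_singleton nW) Ox.
case: k k0 kp px {Wc} => // k _ kp px.
have fpp : chain D k (f p) p.
  by have := chain_orbit Omf k vD (Omf Op); rewrite -iterSr kp.
exists (l + (l + (k + k)))%N.
have -> : (l + (l + (k + k))).+1 = (l + (l + (k + k.+1)))%N by rewrite !addnS.
by apply: chain_cat fxq _; apply: chain_cat qfp _; exact: chain_cat fpp px.
Qed.

(** Close periodic orbits are chain equivalent at every scale: a pseudo-orbit
    that runs along the one for long, then along the other, is shadowed by an
    orbit which expansivity forces to come very close to both. *)
Lemma close_periodic_link : exists2 D0, vicinity D0 & forall p q k l,
  (0 < k)%N -> (0 < l)%N -> iter k f p = p -> iter l f q = q ->
  D0 (p, q) -> D0 (q, p) -> link p q.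
Proof.
have [E0 vE0 expE0] := f_expansive.
have [D0 vD0 shD0] := f_shadowing vE0.
exists D0 => // p q k l k0 l0 kp lq Dpq Dqp D vD.
have Op : Om p by apply: periodic_Om; exists k.
have Oq : Om q by apply: periodic_Om; exists l.
pose E := [set ab | D (f ab.1, f ab.2)] `&` [set ab | D (ab.2, ab.1)].
have vE : vicinity E.
  by apply: vicinityI; [exact: (vicinity_preimage f_cont vD)|exact: (vicinity_swap vD)].
have [N HN] := expE0 E vE.
(* A common period of [p] and [q], longer than the window of expansivity. *)
pose K := (l * k * N.*2.+2)%N.
have Kp : iter K f p = p.
  rewrite /K mulnC; exact: (iter_period _ (iter_period l kp)).
have Kq : iter K f q = q.
  rewrite /K [(l * k)%N]mulnC mulnC; exact: (iter_period _ (iter_period k lq)).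
have KN : (N.*2.+1 < K)%N by rewrite /K leq_pmull// muln_gt0 l0 k0.
have [K' KK'] : exists K', K = K'.+2 by exists K.-2; case: (K) KN => [|[]].
pose s i := if (i < K)%N then iter i f p else q.
pose t i := if (i < K)%N then iter i f q else p.
have K0 : (0 < K)%N by exact: leq_trans KN.
have seg u v : Om u -> iter K f u = u -> D0 (u, v) -> forall i, (i < K)%N ->
    D0 (f (if (i < K)%N then iter i f u else v), if (i.+1 < K)%N then iter i.+1 f u else v).
  move=> Ou Ku Duv i iK; rewrite iK; move: (iK); rewrite leq_eqVlt.
  by move=> /orP[/eqP eK|iK1]; [rewrite -iterS eK ltnn Ku|rewrite iK1; exact: vicinity_refl].
have [|||||||z [zK zs zt]] := @shadow_two_segments _ f Om E0 D0 K K s t shD0.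
- by rewrite addn_gt0 K0.
- by rewrite /s /t ltnn K0.
- by rewrite /s /t ltnn K0.
- by move=> i _; rewrite /s; case: ifP => // _; exact: Om_iter.
- by move=> i _; rewrite /t; case: ifP => // _; exact: Om_iter.
- exact: seg.
- exact: seg.
have Oz : Om z by apply: periodic_Om; exists (K + K)%N => //; rewrite addn_gt0 K0.
have iK i : (i <= N.*2)%N -> (i < K)%N.
  by move=> iN; apply: leq_ltn_trans KN; exact: leq_trans (leqnSn _).
have [zp1 zp2] : E (iter N f p, iter N f z).
  by apply: HN => // i /iK iltK; have := zs i iltK; rewrite /s iltK.
have [zq1 zq2] : E (iter N f q, iter N f (iter K f z)).
  apply: HN => //; first exact: Om_iter.
  by move=> i /iK iltK; have := zt i iltK; rewrite /t iltK -iterD addnC.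
have c1 := chain_orbit Omf N vD Op.
have c2 : chain D 1 (iter N f p) (iter N.+1 f z).
  by apply: chain_step; [exact: Om_iter|exact: zp1].
have c3 := chain_orbit Omf K' vD (Om_iter Omf N.+1 Oz).
have c4 : chain D 1 (iter K' f (iter N.+1 f z)) (iter N f q).
  apply: chain_step; first exact: Om_iter.
  have -> : f (iter K' f (iter N.+1 f z)) = iter N f (iter K f z).
    by rewrite -iterS -!iterD KK'; congr (iter _ f z); rewrite !addnS addSn addnC.
  exact: zq2.
have NK : (N <= K)%N.
  by apply: leq_trans (ltnW KN); rewrite -addnn -addnS leq_addr.
have c5 := chain_orbit Omf (K - N) vD (Om_iter Omf N Oq).
rewrite -iterD subnK// Kq in c5.
(* The shadowing orbit is left and entered in the middle of the two windows. *)
have c := chain_cat c1 (chain_cat c2 (chain_cat c3 (chain_cat c4 c5))).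
by move: c; rewrite add1n addnS => c; eexists; exact: c.
Qed.

(** The classes are open in [Om]: it suffices to move slightly to periodic points
    that are close to each other. *)
Lemma chain_equiv_near x : Om x ->
  exists2 W, nbhs x W & forall y, W y -> Om y -> chain_equiv x y.
Proof.
move=> Ox; have [D0 vD0 D0link] := close_periodic_link.
have [U [oU Ux UD]] := vicinity_square x vD0.
exists U; first exact: open_nbhs_nbhs.
have key y y' : U y -> Om y -> U y' -> Om y' -> link y y'.
  move=> Uy Oy Uy' Oy' D vD.
  have nUy : nbhs y U by exact: open_nbhs_nbhs.
  have nUy' : nbhs y' U by exact: open_nbhs_nbhs.
  have [p [k [W [[k0 kp Up Op] nW _ Wc]]]] := chain_periodic vD Oy nUy.
  have [q [l [W' [[l0 lq Uq Oq] nW' _ Wc']]]] := chain_periodic vD Oy' nUy'.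
  have [n pq] := D0link p q k l k0 l0 kp lq (UD _ _ Up Uq) (UD _ _ Uq Up) D vD.
  have [yp _] := Wc y (nbhs_singleton nW) Oy.
  have [_ qy] := Wc' y' (nbhs_singleton nW') Oy'.
  exists (k + (n + l))%N; rewrite -addnS -addSn.
  by apply: chain_cat yp _; exact: chain_cat pq qy.
by move=> y Uy Oy; split => //; exact: key.
Qed.

Lemma vicinity_chain_equiv :
  vicinity [set ab | Om ab.1 -> Om ab.2 -> chain_equiv ab.1 ab.2].
Proof.
apply: square_vicinity => x; have [Ox|nOx] := pselect (Om x).
  have [W nW Wc] := chain_equiv_near Ox; exists W => // a b Wa Wb /= Oa Ob.
  by apply: chain_equiv_trans (chain_equiv_sym (Wc _ Wa Oa)) (Wc _ Wb Ob).
exists (~` Om); last by move=> a b na _ /= /na.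
by apply: open_nbhs_nbhs; split => //; exact: closed_openC.
Qed.

(** Shadow a closed chain through both open sets; the shadowing orbit belongs to
    the class because the classes are open. *)
Lemma chain_equiv_transitive x : Om x -> transitive_on f (chain_equiv x).
Proof.
move=> Ox U V oU oV [a [xa Ua]] [b [xb Vb]].
have nU : nbhs a U by exact: open_nbhs_nbhs.
have nV : nbhs b V by exact: open_nbhs_nbhs.
have [D vD shD] := f_shadowing (vicinityI vicinity_chain_equiv
  (vicinityI (vicinity_at M_hausdorff nU) (vicinity_at M_hausdorff nV))).
have [Oa Ob ab ba] := chain_equiv_trans (chain_equiv_sym xa) xb.
have [m cm] := ab D vD; have [n cn] := ba D vD.
have [z [zmn [//|[az [Uz _]]] [bz [_ Vz]]]] := shadow_closed_chain shD Oa (ltn0Sn n) cm cn.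
have Oz : Om z by apply: periodic_Om; exists (m.+1 + n.+1)%N.
have Ofz : Om (iter m.+1 f z) by exact: Om_iter.
exists m.+1 => //; exists (iter m.+1 f z); split.
  exists z => //; split; last exact: Uz.
  exact: chain_equiv_trans xa (az Oa Oz).
split; last exact: Vz.
exact: chain_equiv_trans xb (bz Ob Ofz).
Qed.

Lemma chain_equiv_closed x : closed (chain_equiv x).
Proof.
have [Ox|nOx] := pselect (Om x); last first.
  suff -> : chain_equiv x = set0 by exact: closed0.
  by apply/seteqP; split => // y [].
move=> y cy; have Oy : Om y.
  by apply: Om_closed; apply: closure_subset cy => z [].
have [W nW Wc] := chain_equiv_near Oy; have [z [xz Wz]] := cy W nW.
have [_ Oz _ _] := xz.
by apply: (chain_equiv_trans xz); exact/chain_equiv_sym/Wc.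
Qed.

Lemma image_chain_equiv x : f @` chain_equiv x = chain_equiv x.
Proof.
apply/seteqP; split => [_ [y xy <-]|y xy].
  by apply: (chain_equiv_trans xy); apply: chain_equiv_f; case: xy.
have : (f @` Om) y by rewrite f_Om; case: xy.
move=> [z Oz zy]; exists z => //; apply: (chain_equiv_trans xy).
by apply: chain_equiv_sym; rewrite -zy; exact: chain_equiv_f.
Qed.

Section OneClass.
Variable c : M.
Hypothesis Oc : Om c.
Local Notation C := (chain_equiv c).

Let CO y : C y -> Om y. Proof. by case. Qed.

(** From now on [D1] is a scale at which shadowing does not leave the class. *)
Variable D1 : set (M * M).
Hypothesis vD1 : vicinity D1.
Hypothesis shD1 : shadows f Om D1 [set ab | Om ab.1 -> Om ab.2 -> chain_equiv ab.1 ab.2].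

Lemma chain_equiv_iter n y : C y -> C (iter n f y).
Proof.
move=> Cy; elim: n => //= n IH; apply: (chain_equiv_trans IH).
by apply: chain_equiv_f; exact: CO.
Qed.

Lemma closed_chain_period y n : C y -> (0 < n)%N -> chain D1 n y y ->
  exists2 p, C p & iter n f p = p.
Proof.
move=> Cy n0 yy; have Oy := CO Cy.
have [z [zn _ yz]] := @shadow_closed_chain _ f Om _ _ 0 n y y shD1 Oy n0 erefl yy.
rewrite add0n in zn; exists z => //; apply: chain_equiv_trans Cy (yz Oy _).
by apply: periodic_Om; exists n.
Qed.

(** Chains from [c] to [p] and back, with and without a turn along the orbit of
    [p], have lengths that differ by [k]. *)
Lemma cycle_period_dvd D d p k : vicinity D -> C p -> iter k f p = p ->
  (forall n, (0 < n)%N /\ chain D n c c -> (d %| n)%N) -> (d %| k)%N.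
Proof.
move=> vD [_ Op cp pc] kp dD.
have [m cm] := cp D vD; have [n cn] := pc D vD.
have /dD h1 : (0 < m.+1 + n.+1)%N /\ chain D (m.+1 + n.+1) c c.
  by split => //; exact: chain_cat cm cn.
have /dD h2 : (0 < m.+1 + (k + n.+1))%N /\ chain D (m.+1 + (k + n.+1)) c c.
  split => //; apply: chain_cat cm _; apply: chain_cat cn.
  by rewrite -{2}kp; exact: chain_orbit.
by move: h2; rewrite addnCA dvdn_addl.
Qed.

(** The lengths of closed [D]-chains through [c] form a semigroup, to which
    [semigroup_multiples] attaches an integer.  The integer of [D1] serves at every
    scale: the integer of any [D] divides the periods of the periodic points of
    the class, by [cycle_period_dvd], and all closed [D1]-chains have lengths that
    are such periods, by shadowing. *)
Lemma class_period : exists d, [/\ (0 < d)%N,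
  forall y n, C y -> chain D1 n y y -> (d %| n)%N &
  forall D, vicinity D -> exists N, forall k, (N <= k)%N -> chain D (d * k) c c].
Proof.
have sg D : vicinity D -> exists d, [/\ (0 < d)%N,
    forall n, (0 < n)%N /\ chain D n c c -> (d %| n)%N &
    exists N, forall k, (N <= k)%N -> (0 < d * k)%N /\ chain D (d * k) c c].
  move=> vD; apply: (@semigroup_multiples (fun n => (0 < n)%N /\ chain D n c c)).
    by have [n cn] := link_refl Oc vD; exists n.+1.
  move=> a b [a0 ca] [b0 cb]; split; first by rewrite addn_gt0 a0.
  exact: chain_cat ca cb.
have [d [d0 dD dN]] := sg D1 vD1.
exists d; split => //.
  move=> y n Cy cyy; have [->//|n0] := posnP n.
  have [p Cp np] := closed_chain_period Cy n0 cyy.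
  exact: cycle_period_dvd vD1 Cp np dD.
move=> D vD; have [e [e0 eD [N eN]]] := sg D vD.
have ed : (e %| d)%N.
  have D1e n : (0 < n)%N /\ chain D1 n c c -> (e %| n)%N.
    move=> [n0 cn]; have [p Cp np] := closed_chain_period (chain_equiv_refl Oc) n0 cn.
    exact: cycle_period_dvd vD Cp np eD.
  have [K dK] := dN.
  have /D1e h1 := dK K (leqnn _); have /D1e h2 := dK K.+1 (leqnSn _).
  by move: h2; rewrite mulnS dvdn_addl.
have /dvdnP[q dq] := ed.
have q0 : (0 < q)%N by move: d0; rewrite dq muln_gt0 => /andP[].
exists N => k Nk; rewrite dq [(q * e)%N]mulnC -mulnA.
by have [] := eN (q * k)%N _ => //; apply: leq_trans Nk _; exact: leq_pmull.
Qed.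

(** The pieces are the sets of points that chains from [c] reach in a given number
    of steps modulo the period [d] of the class.  They are open in the class
    since two close points are joined through a common periodic point, by a
    chain of length a multiple of [d].  Inside one piece every large multiple of
    [d] is the length of a chain from [x] to [y], so that shadowing gives mixing
    of the [d]-th iterate. *)
Lemma class_mixing_decomposition :
  exists n (X : 'I_n -> set M), (0 < n)%N /\ mixing_decomposition f C X.
Proof.
have [d [d0 dC dN]] := class_period.
pose X (j : 'I_d) := [set y | C y /\ exists2 m, chain D1 m c y & (m %% d = j)%N].
exists d, X; split => //.
have lenmod y m m' : C y -> chain D1 m c y -> chain D1 m' c y -> (m = m' %[mod d])%N.
  move=> [_ Oy _ yc] cm cm'; have [l cl] := yc D1 vD1.
  have /eqP h1 := dC c _ (chain_equiv_refl Oc) (chain_cat cm cl).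
  have /eqP h2 := dC c _ (chain_equiv_refl Oc) (chain_cat cm' cl).
  by apply/eqP; rewrite -(eqn_modDr l.+1) h1 h2.
have Xuniq y j j' : X j y -> X j' y -> j = j'.
  move=> [Cy [m cm mj]] [_ [m' cm' mj']]; apply: ord_inj; rewrite -mj -mj'.
  exact: lenmod cm cm'.
have Xext y z l j : X j y -> chain D1 l y z -> C z ->
    exists2 m, chain D1 m c z & (m = j + l %[mod d])%N.
  move=> [Cy [m cm mj]] cl Cz; exists (m + l)%N; first exact: chain_cat cm cl.
  by rewrite -mj modnDml.
have Xdvd y z l j : X j y -> chain D1 l y z -> C z -> (d %| l)%N -> X j z.
  move=> Xy cl Cz /eqP dl; have [m cm mj] := Xext _ _ _ _ Xy cl Cz.
  by split => //; exists m => //; rewrite mj -modnDmr dl addn0 modn_small.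
have near y : C y -> exists2 W, nbhs y W & forall z, W z -> Om z ->
    C z /\ exists2 l, chain D1 l y z /\ chain D1 l z y & (d %| l)%N.
  move=> Cy; have Oy := CO Cy; have [V nV Vc] := chain_equiv_near Oy.
  have [p [k [W [[k0 kp Vp Op] nW WV Wc]]]] := chain_periodic vD1 Oy nV.
  exists W => // z Wz Oz; have Cz : C z by apply: chain_equiv_trans Cy (Vc z (WV z Wz) Oz).
  split => //; exists (k + k)%N.
    have [yp py] := Wc y (nbhs_singleton nW) Oy; have [zp pz] := Wc z Wz Oz.
    by split; [exact: chain_cat yp pz|exact: chain_cat zp py].
  have Cp : C p by exact: chain_equiv_trans Cy (Vc p Vp Op).
  have dk : (d %| k)%N by apply: dC Cp _; rewrite -{2}kp; exact: chain_orbit.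
  exact: dvdn_add.
split.
- apply/seteqP; split => [y [j _ [] //]|y Cy].
  have [_ _ cy _] := Cy; have [m cm] := cy D1 vD1.
  by exists (Ordinal (ltn_pmod m.+1 d0)) => //; split => //; exists m.+1.
- by move=> j j' _ _ [y [Xj Xj']]; exact: Xuniq Xj Xj'.
- move=> j y cy; have Cy : C y.
    by apply: chain_equiv_closed; apply: closure_subset cy => z [].
  have [W nW Wn] := near y Cy; have [z [Xz Wz]] := cy W nW.
  have Oz : Om z by case: Xz => -[].
  have [Cz [l [yz zy] dl]] := Wn z Wz Oz.
  exact: Xdvd Xz zy Cy dl.
- move=> j; have stepX i y : X i y -> X (ordS i) (f y).
    move=> Xy; have [Cy _] := Xy; have Cfy := chain_equiv_iter 1 Cy.
    have := chain_orbit Omf 1 vD1 (CO Cy) => c1.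
    have [m cm mj] := Xext _ _ _ _ Xy c1 Cfy.
    by split => //; exists m => //; rewrite mj addn1.
  apply/seteqP; split => [_ [y Xy <-]|y Xy]; first exact: stepX.
  have [Cy _] := Xy; move: (Cy); rewrite -image_chain_equiv => -[z Cz zy].
  have [_ _ cz _] := Cz; have [m cm] := cz D1 vD1.
  have Xz : X (Ordinal (ltn_pmod m.+1 d0)) z by split => //; exists m.+1.
  exists z => //; have := stepX _ _ Xz; rewrite zy => Xy'.
  by have /ordS_inj <- := Xuniq _ _ _ Xy' Xy.
move=> j U V oU oV [x [Xx Ux]] [y [Xy Vy]].
have [Cx _] := Xx; have [Cy _] := Xy.
have Ox := CO Cx; have Oy := CO Cy.
have [W nW Wn] := near x Cx.
have nU : nbhs x (U `&` W) by apply: filterI => //; exact: open_nbhs_nbhs.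
have nV : nbhs y V by exact: open_nbhs_nbhs.
have [D vD shD] := f_shadowing
  (vicinityI (vicinity_at M_hausdorff nU) (vicinity_at M_hausdorff nV)).
have vDD := vicinityI vD vD1.
have [_ _ cx xc] := Cx; have [_ _ cy yc] := Cy.
have [a ca] := xc _ vDD; have [b cb] := cy _ vDD.
have [e ce] := link_trans yc cx vDD.
have [N DN] := dN _ vDD.
have /dvdnP[q abq] : (d %| a.+1 + b.+1)%N.
  have cab : chain D1 (a.+1 + b.+1) x y.
    by apply: chain_sub (chain_cat ca cb) => ? [].
  have [m cm mj] := Xext _ _ _ _ Xx cab Cy.
  have [_ [m' cm' mj']] := Xy.
  have := lenmod _ _ _ Cy cm cm'; rewrite mj mj' => /eqP h.
  by rewrite /dvdn -(mod0n d) -(eqn_modDl j) addn0 (eqP h) modn_small.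
exists (N + q).+1 => // n Nn.
have qn : (N <= n - q)%N by rewrite -(addnK q N) leq_sub2r// ltnW.
have cxy : chain (D `&` D1) (d * n) x y.
  have -> : (d * n = a.+1 + (d * (n - q) + b.+1))%N.
    rewrite addnCA abq [(q * d)%N]mulnC -mulnDr subnK//.
    by apply: leq_trans (ltnW Nn); exact: leq_addl.
  by apply: chain_cat ca _; exact: chain_cat (DN _ qn) cb.
have cyx := chain_sub (@subIsetl _ D D1) ce.
have dn0 : (0 < d * n)%N by rewrite muln_gt0 d0/=; exact: leq_trans Nn.
have [z [zn [dn|[xz yz0]] [_ yz]]] := shadow_closed_chain shD Ox (ltn0Sn e)
  (chain_sub (@subIsetl _ D D1) cxy) cyx.
  by rewrite dn in dn0.
have [Uz Wz] := xz erefl.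
have Oz : Om z by apply: periodic_Om; exists (d * n + e.+1)%N => //; rewrite addn_gt0 dn0.
have [Cz [l [xlz _] dl]] := Wn z Wz Oz.
have Xz : X j z by exact: Xdvd Xx xlz Cz dl.
have itn : iter n (iter d f) z = iter (d * n) f z by rewrite mulnC iterM.
exists (iter (d * n) f z); split; first by exists z.
split; last exact: yz.
apply: Xdvd Xz (chain_orbit Omf _ vD1 Oz) (chain_equiv_iter _ Cz) _.
exact: dvdn_mulr.
Qed.

End OneClass.

Lemma chain_equiv_eq x y : chain_equiv x y -> chain_equiv x = chain_equiv y.
Proof.
move=> xy; apply/seteqP; split => z; last exact: chain_equiv_trans.
by apply: chain_equiv_trans; exact: chain_equiv_sym.
Qed.

Lemma finite_chain_classes : finite_set (chain_equiv @` Om).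
Proof.
pose W x := [set y | Om y -> chain_equiv x y].
have [x /chain_equiv_near[V nV VW]|s [sO sW]] := compact_finite_nbhs (W := W) Om_compact.
  by apply: filterS nV => y /VW.
apply: (@sub_finite_set _ _ (chain_equiv @` [set` s])); last first.
  exact/finite_image/finite_seq.
move=> _ [y Oy <-]; have [x xs xy] := sW y Oy.
by exists x => //; exact/chain_equiv_eq/xy.
Qed.

End ChainClasses.

(** * The decomposition and its uniqueness *)

(** The pieces are the chain classes, finite in number because they are open in a
    compact set. *)
Lemma spectral_decomposition_exists (M : topologicalType) (f : M -> M) :
  hausdorff_space M -> continuous f -> compact (nonwandering f) ->
  f @` nonwandering f = nonwandering f ->
  nonwandering f `<=` closure (periodic f) ->
  shadowing f (nonwandering f) -> expansive f (nonwandering f) ->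
  exists (s : nat) (Om : 'I_s -> set M), spectral_decomposition f Om.
Proof.
move=> hM cf cpt fO Oper sh ex.
have perO : periodic f `<=` nonwandering f.
  move=> x [k k0 kx] U nU N N0; exists (N.+1 * k)%N; first exact: leq_pmulr.
  exists x; split; last exact: nbhs_singleton nU.
  by exists x; [exact: nbhs_singleton nU|exact: iter_period].
set O := nonwandering f in cpt fO Oper sh ex perO *.
pose C := chain_equiv f O.
have Crefl x : O x -> C x x by move=> Ox; exact: chain_equiv_refl.
have Ceq x y : C x y -> C x = C y by exact: chain_equiv_eq.
have /finite_fsetP[A AE] : finite_set (C @` O) by exact: finite_chain_classes.
have AP X : X \in A -> exists2 x, O x & C x = X.
  by move=> XA; have : [set` A] X by []; rewrite -AE.
pose cls (i : 'I_(size (enum_fset A))) := nth set0 (enum_fset A) i.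
have clsP i : exists2 x, O x & C x = cls i by apply: AP; exact: mem_nth.
exists (size (enum_fset A)), cls; split.
- apply/seteqP; split => [y [i _]|y Oy].
    by have [x Ox <-] := clsP i; case.
  have CA : C y \in enum_fset A.
    by have : [set` A] (C y) by rewrite -AE; exists y.
  have iA : (index (C y) (enum_fset A) < size (enum_fset A))%N by rewrite index_mem.
  by exists (Ordinal iA) => //; rewrite /cls /= nth_index//; exact: Crefl.
- move=> i j _ _ [y []]; have [x Ox xi] := clsP i; have [z Oz zj] := clsP j.
  rewrite -xi -zj => xy zy; apply: ord_inj; apply/eqP.
  rewrite -(nth_uniq set0 (ltn_ord i) (ltn_ord j) (fset_uniq A)).
  by apply/eqP; rewrite -/(cls i) -/(cls j) -xi -zj (Ceq _ _ xy) (Ceq _ _ zy).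
- move=> i; have [x Ox <-] := clsP i; split; first by exists x; exact: Crefl.
    exact: chain_equiv_closed.
  exact: image_chain_equiv.
- by move=> i; have [x Ox <-] := clsP i; exact: chain_equiv_transitive.
move=> i; have [x Ox <-] := clsP i.
have [D vD shD] := sh _ (vicinity_chain_equiv hM cf cpt fO perO Oper sh ex).
by apply: class_mixing_decomposition vD shD.
Qed.

(** Being finite in number and closed, the pieces of a decomposition are open in
    the nonwandering set, and they are invariant: a transitive piece of another
    decomposition cannot meet two of them. *)
Lemma spectral_decomposition_sub (M : topologicalType) (f : M -> M) s t
    (A : 'I_s -> set M) (B : 'I_t -> set M) (i : 'I_s) (j : 'I_t) :
  spectral_decomposition f A -> spectral_decomposition f B ->
  A i `&` B j !=set0 -> A i `<=` B j.
Proof.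
move=> [Aun Adis Apr Atr _] [Bun Bdis Bpr _ _] [x [Ax Bx]] y Ay.
apply: contrapT => nBy.
have Bcl k : closed (B k) by have [] := Bpr k.
pose V := ~` \bigcup_(k in [set k | k != j]) B k.
have oV : open V by rewrite openC; apply: closed_bigcup => //; exact: finite_finset.
have Vx : V x.
  by move=> [k /= /eqP kj Bkx]; apply: kj; apply: Bdis => //; exists x.
have [||n n0 [_ [[z [Az Vz] <-] [_]]]] := Atr i V (~` B j) oV (closed_openC (Bcl j)).
- by exists x.
- by exists y.
apply.
have Bz : B j z.
  have : (\bigcup_k B k) z by rewrite Bun -Aun; exists i.
  move=> [k _ Bkz]; have [<-//|kj] := eqVneq k j.
  by exfalso; apply: Vz; exists k.
elim: n {n0} => //= n IH; have [_ _ <-] := Bpr j.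
by exists (iter n f z).
Qed.

Lemma spectral_decomposition_uniq (M : topologicalType) (f : M -> M) s t
    (A : 'I_s -> set M) (B : 'I_t -> set M) :
  spectral_decomposition f A -> spectral_decomposition f B ->
  exists2 sigma : 'I_t -> 'I_s, bijective sigma & forall i, B i = A (sigma i).
Proof.
move=> dA dB.
have match_ s1 s2 (A1 : 'I_s1 -> set M) (A2 : 'I_s2 -> set M) :
    spectral_decomposition f A1 -> spectral_decomposition f A2 ->
    forall i, exists j, A1 i = A2 j.
  move=> d1 d2 i; have [U1 _ /(_ i)[[x Ax] _ _] _ _] := d1.
  have [U2 _ _ _ _] := d2.
  have [j _ Bx] : (\bigcup_j A2 j) x by rewrite U2 -U1; exists i.
  exists j; apply/seteqP; split; first by apply: spectral_decomposition_sub d1 d2 _; exists x.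
  by apply: spectral_decomposition_sub d2 d1 _; exists x.
have inj s1 (A1 : 'I_s1 -> set M) i j :
    spectral_decomposition f A1 -> A1 i = A1 j -> i = j.
  move=> [_ dis /(_ i)[[x Ax] _ _] _ _] ij; apply: dis => //.
  by exists x; split => //; rewrite -ij.
have /choice[sigma sE] := match_ _ _ _ _ dB dA.
have /choice[tau tE] := match_ _ _ _ _ dA dB.
exists sigma => //; exists tau => i.
  by apply: inj dB _; rewrite -tE -sE.
by apply: inj dA _; rewrite -sE -tE.
Qed.

Local Open Scope ring_scope.

(** * Calculus in finite dimension *)

Lemma near_eq_diff (R : realType) (V W : normedModType R) (f g : V -> W) (x : V) :
  (\forall y \near x, f y = g y) -> differentiable f x ->
  differentiable g x /\ 'd g x = 'd f x :> (V -> W).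
Proof.
move=> fg df.
have fgx : f x = g x by exact: nbhs_singleton fg.
have cdf : continuous ('d f x) by exact: diff_continuous.
have dg : g \o shift x = cst (g x) + 'd f x +o_ 0 id.
  apply/eqaddoP => e e0.
  have /eqaddoP/(_ e e0) H := diff_locally df.
  have fg0 : \forall h \near (0 : V), f (h + x) = g (h + x).
    move: fg; rewrite (near_shift 0)/=; apply: filterS => h /=.
    by rewrite subr0.
  apply: filterS2 fg0 H => h fgh.
  by rewrite !fctE /= fgh fgx.
have Dg : 'd g x = 'd f x :> (V -> W) by exact: diff_unique.
split; last exact: Dg.
apply/diff_locallyP; rewrite Dg; exact: (conj cdf dg).
Qed.

Lemma mx_entry_norm_le (R : realType) (m n : nat) (A : 'M[R]_(m, n)) i j : `|A i j| <= `|A|.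
Proof.
rewrite [leRHS]/Num.norm /= mx_normrE.
exact: (le_bigmax _ (fun ij : 'I_m * 'I_n => `|A ij.1 ij.2|) (i, j)).
Qed.

Lemma mx_norm_le (R : realType) (m n : nat) (A : 'M[R]_(m, n)) (e : R) :
  0 <= e -> (forall i j, `|A i j| <= e) -> `|A| <= e.
Proof.
move=> e0 H; rewrite [leLHS]/Num.norm /= mx_normrE; by apply/bigmax_leP.
Qed.

Lemma linear_rV_expand (R : realType) (d : nat) (W : lmodType R)
    (A : {linear 'rV[R]_d -> W}) (w : 'rV[R]_d) :
  A w = \sum_j w ord0 j *: A (delta_mx ord0 j).
Proof.
by rewrite {1}(row_sum_delta w) linear_sum; apply: eq_bigr => j _; rewrite linearZ.
Qed.

(** The norm of [R^d] being the largest coordinate, the [d] basis vectors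
    contribute at most [e / d.+1] each; [d.+1] also covers [d = 0]. *)
Lemma linear_rV_bound (R : realType) (d : nat) (W : normedModType R)
    (A : 'rV[R]_d -> W) (e : R) :
  (exists L : {linear 'rV[R]_d -> W}, A = L :> (_ -> _)) ->
  (forall j, `|A (delta_mx ord0 j)| <= e / d.+1%:R) -> forall w, `|A w| <= e * `|w|.
Proof.
move=> [L ->] H w.
have [d0|dpos] := posnP d.
  by subst d; rewrite (thinmx0 w) linear0 !normr0 mulr0.
rewrite linear_rV_expand.
have e0 : 0 <= e.
  by have := le_trans (normr_ge0 _) (H (Ordinal dpos)); rewrite pmulr_lge0.
apply: le_trans (ler_norm_sum _ _ _) _.
apply: (@le_trans _ _ (\sum_(j < d) e / d.+1%:R * `|w|)).
  apply: ler_sum => j _; rewrite normrZ mulrC ler_pM //.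
  exact: mx_entry_norm_le.
rewrite sumr_const card_ord -[leLHS]mulr_natr [leLHS]mulrAC ler_wpM2r//.
by rewrite -mulrA ler_piMr// mulrC ler_pdivrMr// mul1r ler_nat.
Qed.

(** The mean value theorem along the segment, for each coordinate: these attain
    their mean slopes at different points, but the norm is the largest coordinate. *)
Lemma mean_value_ineq (R : realType) (V : normedModType R) (d : nat)
    (F : V -> 'rV[R]_d) (L : {linear V -> 'rV[R]_d}) (e : R) (u v : V) :
  0 <= e ->
  (forall t : R, 0 <= t <= 1 -> differentiable F (v + t *: (u - v))) ->
  (forall t : R, 0 <= t <= 1 ->
     `|'d F (v + t *: (u - v)) (u - v) - L (u - v)| <= e * `|u - v|) ->
  `|F u - F v - L (u - v)| <= e * `|u - v|.
Proof.
move=> e0 dF bF; apply: mx_norm_le => [|i j]; first by rewrite mulr_ge0.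
set h := u - v; pose c (t : R) := v + t *: h.
pose G (t : R) : R := F (c t) i j.
have dc (t : R) : is_diff t c (fun s => s *: h).
  have := is_diffD (is_diff_cst v t) (is_diff_scalel t h).
  by move=> H; apply: is_diff_eq H _; rewrite add0r.
have dG (t : R) : 0 <= t <= 1 -> is_diff t G (fun s => 'd F (c t) (s *: h) i j).
  move=> t01; have dFc : is_diff (c t) F ('d F (c t)) by apply: differentiableP; exact: dF.
  have dco : is_diff (F (c t)) (fun A : 'rV[R]_d => A i j) (fun A => A i j).
    have cc : continuous (fun A : 'rV[R]_d => A i j) by exact: coord_continuous.
    apply: DiffDef; first exact: differentiable_coord.
    have lin : linear (fun A : 'rV[R]_d => A i j : R) by move=> k a b; rewrite !mxE.
    pose f := GRing.isLinear.Build _ _ _ _ _ lin.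
    pose g : {linear 'rV[R]_d -> R} := HB.pack (fun A : 'rV[R]_d => A i j : R) f.
    exact: (@diff_lin _ _ _ g (F (c t)) cc).
  exact: is_diff_comp.
have dGd (t : R) : t \in `]0, 1[%R -> is_derive t 1 G ('d F (c t) h i j).
  rewrite in_itv/= => /andP[/ltW t0 /ltW t1].
  have [dfG diffG] : is_diff t G (fun s => 'd F (c t) (s *: h) i j).
    by apply: dG; rewrite t0.
  split; first exact: diff_derivable.
  by rewrite deriveE// diffG scale1r.
have cG : {within `[0, 1], continuous G}.
  apply: continuous_in_subspaceT => t; rewrite inE/= in_itv/= => t01.
  by apply: differentiable_continuous; have [] := dG t t01.
have [t /andP[]] := MVT (ltr01) dGd cG; rewrite !bnd_simp => t0 t1.
rewrite subr0 mulr1 {1 2}/G /c scale1r scale0r addr0 [v + h]addrC subrK => E.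
rewrite !mxE E.
have t01 : 0 <= t <= 1 by rewrite (ltW t0) (ltW t1).
apply: le_trans (bF t t01).
by have := mx_entry_norm_le ('d F (v + t *: h) h - L h) i j; rewrite !mxE.
Qed.

(** * Periodic solutions of almost linear recursions *)

(* Joins the complete and the normed structures of matrices, as the contraction
   principle requires. *)
HB.instance Definition _ (R : realType) (m n : nat) := Complete.on 'M[R]_(m, n).

(** A bound from below makes the map injective, hence surjective for mere reasons
    of dimension. *)
Lemma linear_bounded_below_section (R : realType) (n d : nat)
    (T : {linear 'M[R]_(n, d) -> 'M[R]_(n, d)}) (k : R) :
  (forall v, `|v| <= k * `|T v|) -> exists S : 'M[R]_(n, d) -> 'M[R]_(n, d), cancel S T.
Proof.
move=> kT; pose F := linfun T.
have F0 : lker F == 0%VS.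
  apply/lker0P => u v; rewrite !lfunE /= => Tuv.
  apply/eqP; rewrite -subr_eq0 -normr_le0; apply: le_trans (kT _) _.
  by rewrite linearB Tuv subrr normr0 mulr0.
exists (F^-1)%VF => v; have := lker0_lfunVK F0 v.
by rewrite [LHS]lfunE.
Qed.

(** The contraction principle, applied to [N] followed by a right inverse of [T];
    the inverse is Lipschitz with the constant of the bound from below. *)
Lemma linear_perturbation_solution (R : realType) (n d : nat)
    (T : {linear 'M[R]_(n, d) -> 'M[R]_(n, d)}) (N : 'M[R]_(n, d) -> 'M[R]_(n, d))
    (k eta delta rho : R) :
  0 <= k -> (forall v, `|v| <= k * `|T v|) -> 0 < rho ->
  (forall u v, `|u| <= rho -> `|v| <= rho -> `|N u - N v| <= eta * `|u - v|) ->
  `|N 0| <= delta -> k * eta <= 2^-1 -> k * delta <= rho / 2 ->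
  exists2 v, `|v| <= rho & T v = N v.
Proof.
move=> k0 kT rho0 Nlip N0 keta kdelta.
have [S ST] := linear_bounded_below_section kT.
have Slip u v : `|S u - S v| <= k * `|u - v|.
  by apply: le_trans (kT _) _; rewrite linearB !ST.
have S0 : S 0 = 0.
  by apply/eqP; rewrite -normr_le0; apply: le_trans (kT _) _; rewrite ST normr0 mulr0.
pose U : set 'M[R]_(n, d) := [set v | `|v| <= rho].
pose h v := S (N v).
have hlip u v : U u -> U v -> `|h u - h v| <= 2^-1 * `|u - v|.
  move=> Uu Uv; apply: le_trans (Slip _ _) _.
  apply: le_trans (ler_wpM2l k0 (Nlip _ _ Uu Uv)) _.
  by rewrite mulrA ler_wpM2r.
have U0 : U 0 by rewrite /U /= normr0 ltW.
have h0 : `|h 0| <= rho / 2.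
  have := Slip (N 0) 0; rewrite S0 !subr0 => /le_trans; apply.
  exact: le_trans (ler_wpM2l k0 N0) kdelta.
have hU : {homo h : x / U x >-> U x}.
  move=> v Uv; rewrite /U /=; rewrite -[h v](subrK (h 0)).
  apply: le_trans (ler_normD _ _) _; rewrite [leRHS]splitr; apply: lerD => //.
  apply: le_trans (hlip _ _ Uv U0) _; rewrite subr0 mulrC ler_wpM2r//.
have clU : closed U.
  rewrite (_ : U = (fun u : 'M[R]_(n, d) => `|u|) @^-1` [set t | t <= rho]); last by [].
  apply: preimage_closed; last exact: closed_le.
  by move=> u _; exact: norm_continuous.
have [||v Uv vE] := @banach_fixed_point R _ U (mkfun_fun hU) _ clU.
- exists (2^-1)%:nng; split; first by rewrite /= invf_lt1 ?ltr1n.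
  by move=> [u v] [/= Uu Uv]; exact: hlip.
- by exists 0.
by exists v => //; rewrite {1}vE ST.
Qed.

Lemma mx_row_norm_le (R : realType) (m n : nat) (A : 'M[R]_(m, n)) (e : R) :
  0 <= e -> (forall i, `|row i A| <= e) -> `|A| <= e.
Proof.
move=> e0 H; apply: mx_norm_le => // i j.
by have := le_trans (mx_entry_norm_le (row i A) ord0 j) (H i); rewrite mxE.
Qed.

Lemma row_norm_le (R : realType) (m n : nat) (A : 'M[R]_(m, n)) i : `|row i A| <= `|A|.
Proof. by apply: mx_norm_le => // k j; rewrite mxE; exact: mx_entry_norm_le. Qed.

Lemma periodic_modn (T : Type) (h : nat -> T) n i :
  (forall i, h (i + n)%N = h i) -> h (i %% n)%N = h i.
Proof.
move=> hn; rewrite [in RHS](divn_eq i n) addnC.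
by elim: (i %/ n)%N => [|k IH]; rewrite ?addn0// mulSn addnCA addnC hn.
Qed.

(** The sequences of period [n] form a finite-dimensional space, on which the
    recursion [w i.+1 = G i (w i)] becomes an equation [T w = N w] with [T] linear.
    The a priori estimate on bounded solutions of the linear recursion is a bound
    from below for [T], with a constant that does not depend on [n]. *)
Lemma periodic_recursion_solution (R : realType) (n d m : nat)
    (A : nat -> {linear 'rV[R]_d -> 'rV[R]_d}) (G : nat -> 'rV[R]_d -> 'rV[R]_d)
    (C eta delta rho : R) : (0 < n)%N ->
  (forall i v, A (i + n)%N v = A i v) -> (forall i v, G (i + n)%N v = G i v) ->
  0 <= C -> 0 < rho ->
  (forall (w e : nat -> 'rV[R]_d) (mu nu : R), (forall i, w i.+1 = A i (w i) + e i) ->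
     (forall i, `|w i| <= mu) -> (forall i, `|e i| <= nu) -> 0 <= nu ->
     forall i, `|w (i + m)%N| <= 2^-1 * mu + C * nu) ->
  (forall i u v, `|u| <= rho -> `|v| <= rho ->
     `|G i u - G i v - A i (u - v)| <= eta * `|u - v|) ->
  (forall i, `|G i 0| <= delta) -> 0 <= eta -> 2 * C * eta <= 2^-1 -> 2 * C * delta <= rho / 2 ->
  exists w : nat -> 'rV[R]_d, [/\ forall i, w (i + n)%N = w i, forall i, `|w i| <= rho &
    forall i, w i.+1 = G i (w i)].
Proof.
case: n => // n _ An Gn C0 rho0 est Gstrict Gdelta eta0 Ceta Cdelta.
pose idx i : 'I_n.+1 := Ordinal (ltn_pmod i (ltn0Sn n)).
have idxn i : idx (i + n.+1)%N = idx i by apply: ord_inj; rewrite /= modnDr.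
have idxS i : idx (idx i).+1 = idx i.+1.
  by apply: ord_inj; rewrite /= -addn1 modnDml addn1.
have Aidx i v : A (idx i) v = A i v.
  exact: (periodic_modn (h := fun i => A i v) i (fun i => An i v)).
have Gidx i v : G (idx i) v = G i v.
  exact: (periodic_modn (h := fun i => G i v) i (fun i => Gn i v)).
pose T0 (v : 'M[R]_(n.+1, d)) : 'M[R]_(n.+1, d) :=
  \matrix_k (row (idx k.+1) v - A k (row k v)).
have rowT v (k : 'I_n.+1) : row k (T0 v) = row (idx k.+1) v - A k (row k v).
  by rewrite rowK.
have Tlin : linear T0.
  move=> a u v; apply/row_matrixP => k; rewrite rowT.
  have rl j (w z : 'M[R]_(n.+1, d)) : row j (a *: w + z) = a *: row j w + row j z.
    exact: linearP.
  rewrite !rl !rowT linearP scalerBr opprD; exact: addrACA.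
pose T : {linear 'M[R]_(n.+1, d) -> 'M[R]_(n.+1, d)} :=
  HB.pack T0 (GRing.isLinear.Build _ _ _ _ _ Tlin).
pose N (v : 'M[R]_(n.+1, d)) : 'M[R]_(n.+1, d) :=
  \matrix_k (G k (row k v) - A k (row k v)).
have rowN v (k : 'I_n.+1) : row k (N v) = G k (row k v) - A k (row k v).
  by rewrite rowK.
have rowB (k : 'I_n.+1) (w z : 'M[R]_(n.+1, d)) : row k (w - z) = row k w - row k z.
  exact: linearB.
have kT v : `|v| <= 2 * C * `|T v|.
  have nu0 := normr_ge0 (T v); have mu0 := normr_ge0 v.
  have H := est (fun i => row (idx i) v) (fun i => row (idx i) (T v)) `|v| `|T v|.
  have bound : `|v| <= 2^-1 * `|v| + C * `|T v|.
    apply: mx_row_norm_le; first by rewrite addr_ge0 ?mulr_ge0.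
    move=> k; have := H _ _ _ nu0 (k + m * n)%N.
    rewrite -addnA [(m * n + m)%N]addnC -mulnS.
    have -> : idx (k + m * n.+1)%N = k.
      by apply: ord_inj; rewrite /= addnC modnMDl modn_small.
    apply=> i; [|exact: row_norm_le|exact: row_norm_le].
    by rewrite [row _ (T v)]rowT idxS Aidx addrC subrK.
  by move: bound; lra.
have [v vrho Tv] : exists2 v, `|v| <= rho & T v = N v.
  apply: (@linear_perturbation_solution _ _ _ T N (2 * C) eta delta rho) => //.
  - by rewrite mulr_ge0.
  - move=> u v urho vrho; apply: mx_row_norm_le; first by rewrite mulr_ge0.
    move=> k; have -> : row k (N u - N v) =
        G k (row k u) - G k (row k v) - A k (row k u - row k v).
      have sub4 (x y z t : 'rV[R]_d) : (x - y) - (z - t) = x - z - (y - t).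
        by rewrite !opprB addrACA [RHS]addrACA [- y - z]addrC.
      by rewrite rowB !rowN sub4 -linearB.
    apply: le_trans (Gstrict _ _ _ _ _) _.
    + exact: le_trans (row_norm_le _ _) urho.
    + exact: le_trans (row_norm_le _ _) vrho.
    rewrite ler_wpM2l// -rowB; exact: row_norm_le.
  - apply: mx_row_norm_le => [|k]; first exact: le_trans (Gdelta 0%N).
    by rewrite rowN row0 linear0 subr0; exact: Gdelta.
exists (fun i => row (idx i) v); split => [i|i|i].
- by rewrite idxn.
- exact: le_trans (row_norm_le _ _) vrho.
have := congr1 (row (idx i)) Tv; rewrite rowN [LHS]rowT idxS Gidx => /eqP.
by rewrite subr_eq subrK => /eqP.
Qed.

(** * Differentials in charts *)

Section ChartCalculus.
Variables (R : realType) (d : nat) (M : manifold R d).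
Implicit Types (h : M -> M) (i j k : chart_index M) (x y : M).

Definition chart_rep h i j : 'rV[R]_d -> 'rV[R]_d := chart j \o h \o chart_inv i.

(** The common form of [tangent_map], [to_chart] and [of_chart], so that one chain
    rule serves them all. *)
Definition chart_diff h i j x : {linear 'rV[R]_d -> 'rV[R]_d} :=
  'd (chart_rep h i j) (chart i x).

Definition smooth_at h x := forall i j, chart_dom i x -> chart_dom j (h x) ->
  differentiable (chart_rep h i j) (chart i x).

Lemma near_chart_dom i x : chart_dom i x -> \forall y \near x, chart_dom i y.
Proof. by move=> ix; apply: open_nbhs_nbhs; split => //; exact: chart_dom_open. Qed.

Lemma near_chart_cod i x : chart_dom i x ->
  \forall p \near chart i x, (chart i @` chart_dom i) p.
Proof.
by move=> ix; apply: open_nbhs_nbhs; split; [exact: chart_cod_open|exists x].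
Qed.

Lemma cvg_chart i x : chart_dom i x -> {for x, continuous (chart i)}.
Proof.
move=> ix; have := @chart_continuous _ _ M i.
rewrite continuous_open_subspace; last exact: chart_dom_open.
by move=> H; exact: (H x (mem_set ix)).
Qed.

Lemma cvg_chart_inv i p : (chart i @` chart_dom i) p ->
  {for p, continuous (@chart_inv _ _ M i)}.
Proof.
move=> ip; have := @chart_inv_continuous _ _ M i.
rewrite continuous_open_subspace; last exact: chart_cod_open.
by move=> H; exact: (H p (mem_set ip)).
Qed.

Lemma near_chart i x (P : set 'rV[R]_d) : chart_dom i x ->
  (\forall p \near chart i x, P p) -> \forall y \near x, P (chart i y).
Proof. by move=> ix nP; exact: (cvg_chart ix nP). Qed.

Lemma chart_codK i p : (chart i @` chart_dom i) p ->
  chart_dom i (chart_inv i p) /\ chart i (chart_inv i p) = p.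
Proof. by move=> [x ix <-]; rewrite chartK. Qed.

(** The germ at [chart i x] of a map read in charts only involves points where all
    charts in play are inverse to their parametrizations. *)
Lemma near_chart_rep h i j x : {for x, continuous h} ->
  chart_dom i x -> chart_dom j (h x) ->
  \forall p \near chart i x, [/\ (chart i @` chart_dom i) p,
    chart_dom i (chart_inv i p), chart i (chart_inv i p) = p &
    chart_dom j (h (chart_inv i p))].
Proof.
move=> ch ix jhx.
have ci := near_chart_cod ix.
have cinv : {for chart i x, continuous (@chart_inv _ _ M i)}.
  by apply: cvg_chart_inv; exists x.
have ch' : {for chart i x, continuous (h \o chart_inv i)}.
  by apply: continuous_comp => //; rewrite chartK.
have jd : \forall p \near chart i x, chart_dom j (h (chart_inv i p)).
  by apply: ch'; rewrite /= chartK//; exact: near_chart_dom.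
by apply: filterS2 ci jd => p ip jp; have [] := chart_codK ip.
Qed.

Lemma chart_diff_comp h h' i j k x :
  {for x, continuous h} -> {for h x, continuous h'} ->
  chart_dom i x -> chart_dom j (h x) -> chart_dom k (h' (h x)) ->
  smooth_at h x -> smooth_at h' (h x) ->
  differentiable (chart_rep (h' \o h) i k) (chart i x) /\
  chart_diff (h' \o h) i k x =1 chart_diff h' j k (h x) \o chart_diff h i j x.
Proof.
move=> ch ch' ix jx kx sh sh'.
have dh := sh i j ix jx; have dh' := sh' j k jx kx.
have hE : chart_rep h i j (chart i x) = chart j (h x) by rewrite /chart_rep /= chartK.
have [||D E] := @near_eq_diff R _ _ (chart_rep h' j k \o chart_rep h i j)
  (chart_rep (h' \o h) i k) (chart i x).
- have := near_chart_rep ch ix jx; apply: filterS => p [_ _ _ jp].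
  by rewrite /chart_rep /= chartK.
- by apply: differentiable_comp; [exact: dh|rewrite hE; exact: dh'].
split; first exact: D.
have dh2 : differentiable (chart_rep h' j k) (chart_rep h i j (chart i x)).
  by rewrite hE.
move=> v; apply: etrans (congr1 (@^~ v) E) _.
apply: etrans (congr1 (@^~ v) (diff_comp dh dh2)) _.
by rewrite /chart_diff /= hE.
Qed.

Lemma smooth_at_comp h h' x : {for x, continuous h} -> {for h x, continuous h'} ->
  smooth_at h x -> smooth_at h' (h x) -> smooth_at (h' \o h) x.
Proof.
move=> ch ch' sh sh' i k ix kx.
have jx := chart_at_dom (h x).
by have [] := chart_diff_comp ch ch' ix jx kx sh sh'.
Qed.

(** For [r >= 1] a map of class [C^r] is of class [C^1], whatever [r]: the case
    distinction is on the recursive definition of the classes. *)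
Lemma Ck_on_differentiable (V W : normedModType R) r (U : set V) (F : V -> W) :
  (1 <= r)%N -> Ck_on r U F ->
  (forall p, U p -> differentiable F p) /\
  forall v p, U p -> {for p, continuous (fun q => 'd F q v)}.
Proof.
case: r => // r _ [dF cF]; split => // v p Up.
case: r cF => [|r] /(_ v); first exact.
by move=> [dd _]; exact: differentiable_continuous (dd p Up).
Qed.

Lemma smooth_at_id x : smooth_at id x.
Proof.
move=> i j ix jx; have [+ _] := @chart_smooth _ _ M i j 1%N.
by apply; exists x.
Qed.

Lemma chart_diff_id i x : chart_dom i x -> chart_diff id i i x =1 id.
Proof.
move=> ix v; have [||_ E] := @near_eq_diff R _ _ id (chart_rep id i i) (chart i x).
- have := near_chart_rep (h := id) cvg_id ix ix; apply: filterS => p [_ _ + _].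
  by rewrite /chart_rep /= => ->.
- exact: ex_diff.
apply: etrans (congr1 (@^~ v) E) _.
exact: (congr1 (@^~ v) (@diff_val _ _ _ _ _ _ _ (is_diff_id (chart i x)))).
Qed.

Lemma Cr_smooth_at r h x : (1 <= r)%N -> Cr_map r h -> smooth_at h x.
Proof.
move=> r1 [_ Ch] i j ix jx; have [+ _] := Ck_on_differentiable r1 (Ch i j).
by apply; exists x.
Qed.

Lemma to_chartE i x (v : tangent x) : to_chart i v = chart_diff id (chart_at x) i x v.
Proof. by []. Qed.

Lemma to_chartK i x (v : tangent x) : chart_dom i x -> of_chart i x (to_chart i v) = v.
Proof.
move=> ix; have cx := chart_at_dom x.
have [_ E] := chart_diff_comp (x := x) (h := id) (h' := id) cvg_id cvg_id cx ix cx
  (@smooth_at_id x) (@smooth_at_id x).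
exact: etrans (esym (E v)) (chart_diff_id cx v).
Qed.

Lemma of_chartK i x u : chart_dom i x -> to_chart i (of_chart i x u) = u.
Proof.
move=> ix; have cx := chart_at_dom x.
have [_ E] := chart_diff_comp (x := x) (h := id) (h' := id) cvg_id cvg_id ix cx ix
  (@smooth_at_id x) (@smooth_at_id x).
exact: etrans (esym (E u)) (chart_diff_id ix u).
Qed.

Lemma to_chart_tangent_map h i j x (v : tangent x) :
  {for x, continuous h} -> smooth_at h x -> chart_dom i x -> chart_dom j (h x) ->
  to_chart j (tangent_map h v) = chart_diff h i j x (to_chart i v).
Proof.
move=> ch sh ix jx; have cx := chart_at_dom x; have chx := chart_at_dom (h x).
have [_ E1] := chart_diff_comp (h := h) (h' := id) ch cvg_id cx chx jx
  sh (@smooth_at_id (h x)).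
have [_ E2] := chart_diff_comp (h := id) (h' := h) cvg_id ch cx ix jx
  (@smooth_at_id x) sh.
exact: etrans (esym (E1 v)) (E2 v).
Qed.

End ChartCalculus.

(** * Uniform estimates in a finite atlas *)

(** Finitely many charts, with compact pieces of their domains whose interiors
    cover the manifold, let all estimates be uniform by compactness. *)
Record finite_atlas (R : realType) (d : nat) (M : manifold R d) := FiniteAtlas {
  atlas_size : nat ;
  atlas_chart : 'I_atlas_size -> chart_index M ;
  atlas_set : 'I_atlas_size -> set M ;
  atlas_compact : forall i, compact (atlas_set i) ;
  atlas_sub : forall i, atlas_set i `<=` chart_dom (atlas_chart i) ;
  atlas_nbhs : forall x : M, exists i, nbhs x (atlas_set i) }.

Lemma finite_atlas_exists (R : realType) (d : nat) (M : manifold R d) :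
  compact [set: M] -> inhabited (finite_atlas M).
Proof.
move=> cM.
have loc (p : M) : exists K, [/\ compact K, K `<=` chart_dom (chart_at p) & nbhs p K].
  have pd := chart_at_dom p; set i := chart_at p in pd *.
  have /nbhs_ballP[r /= r0 rsub] := near_chart_cod pd.
  have r20 : 0 < r / 2 by rewrite divr_gt0.
  pose B := closed_ball (chart i p) (r / 2).
  have BE : B = closed_ball_ Num.norm (chart i p) (r / 2) by exact: closed_ballE.
  have Bsub : B `<=` chart i @` chart_dom i.
    move=> q; rewrite BE /closed_ball_ /= => qr; apply: rsub.
    by rewrite -ball_normE /=; apply: le_lt_trans qr _; rewrite ltr_pdivrMr// ltr_pMr// ltr1n.
  exists (@chart_inv _ _ M i @` B); split.
  - apply: continuous_compact.
      by apply: continuous_subspaceW Bsub _; exact: chart_inv_continuous.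
    apply: bounded_closed_compact; last exact: closed_ball_closed.
    exists (`|chart i p| + r / 2); split; first exact: num_real.
    move=> b /ltW rb q; rewrite BE /closed_ball_ /= => qr.
    apply: le_trans rb; rewrite -[q](subKr (chart i p)).
    by apply: le_trans (ler_normB _ _) _; rewrite lerD2l.
  - by move=> _ [q qB <-]; have [] := chart_codK (Bsub q qB).
  have nB : \forall y \near p, B (chart i y).
    apply: near_chart => //; have : nbhs (chart i p) B.
      exact: filterS (@subset_closed_ball _ _ _ _) (nbhsx_ballx _ _ r20).
    exact.
  apply: filterS2 (near_chart_dom pd) nB => y iy By.
  by exists (chart i y) => //; rewrite chartK.
have [K KP] := choice loc.
have [|s [_ sK]] := compact_finite_nbhs (W := fun p => (K p)^°) cM.
  by move=> p _; have [_ _ np] := KP p; exact: nbhs_interior.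
constructor; apply: (@FiniteAtlas _ _ M (size s) (fun i => chart_at (tnth (in_tuple s) i))
  (fun i => K (tnth (in_tuple s) i))).
- by move=> i; have [] := KP (tnth (in_tuple s) i).
- by move=> i; have [] := KP (tnth (in_tuple s) i).
move=> x; have [p ps Kx] := sK x I.
have := ps; rewrite -index_mem => ilt; exists (Ordinal ilt).
by rewrite (tnth_nth p) /= nth_index.
Qed.

Section UniformEstimates.
Variables (R : realType) (d : nat) (M : manifold R d) (A : finite_atlas M).
Local Notation I := 'I_(atlas_size A).
Local Notation K := (@atlas_set _ _ _ A).
Local Notation ph i := (@chart _ _ M (atlas_chart i)).
Local Notation ps i := (@chart_inv _ _ M (atlas_chart i)).
Local Notation dom i := (@chart_dom _ _ M (@atlas_chart _ _ _ A i)).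
Local Notation rep h i j := (chart_rep h (@atlas_chart _ _ _ A i) (@atlas_chart _ _ _ A j)).
Local Notation L h i j := (chart_diff h (@atlas_chart _ _ _ A i) (@atlas_chart _ _ _ A j)).

Let Kdom i x : K i x -> dom i x. Proof. exact: atlas_sub. Qed.

Let Kclosed i : closed (K i).
Proof. by apply: compact_closed; [exact: points_hausdorff|exact: atlas_compact]. Qed.

(** With [vicinity_coord] below: closeness in the coordinates of the atlas and
    closeness for vicinities of the diagonal are equivalent. *)
Lemma near_coord_vicinity E : vicinity E -> \forall rho \near 0^'+,
  forall (i : I) x y, K i x -> dom i y -> `|ph i x - ph i y| < rho -> E (x, y).
Proof.
move=> vE; apply: filter_forall => i.
have := @atlas_compact _ _ _ A i => /compact_near_coveringP cK.
pose P (rho : R) x := forall y, dom i y -> `|ph i x - ph i y| < rho -> E (x, y).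
have : \forall rho \near 0^'+, K i `<=` P rho.
  apply: cK => x0 /Kdom ix0.
  have [U [oU Ux UE]] := vicinity_square x0 vE.
  have inU : \forall p \near ph i x0, U (ps i p).
    have cinv := cvg_chart_inv (ex_intro2 _ _ x0 ix0 erefl).
    by apply: cinv; rewrite chartK//; exact: open_nbhs_nbhs.
  have /nbhs_ballP[e /= e0 eU] := inU.
  have e20 : 0 < e / 2 by rewrite divr_gt0.
  have nx : \forall x \near x0, `|ph i x0 - ph i x| < e / 2.
    by have /cvgrPdist_lt := cvg_chart ix0; apply.
  near=> x rho => y iy xy; have Ux' : U x by near: x; exact: open_nbhs_nbhs.
  have x0x : `|ph i x0 - ph i x| < e / 2 by near: x.
  have rhoe : rho < e / 2 by near: rho; exact: nbhs_right_lt.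
  apply: UE => //.
  rewrite -(chartK iy); apply: eU; rewrite -ball_normE /= [e]splitr.
  apply: le_lt_trans (ler_distD (ph i x) _ _) _; apply: ltrD => //.
  exact: lt_trans xy _.
by apply: filterS => rho KP x y Kx; exact: (KP x Kx y).
Unshelve. all: by end_near. Qed.

Lemma vicinity_coord (rho : R) : 0 < rho -> vicinity [set xy | forall i : I,
  K i xy.1 -> dom i xy.2 /\ `|ph i xy.1 - ph i xy.2| < rho].
Proof.
move=> rho0; have vi (i : I) : vicinity [set xy | K i xy.1 -> dom i xy.2 /\ `|ph i xy.1 - ph i xy.2| < rho].
  apply: square_vicinity => x; have [Kx|nKx] := pselect (K i x); last first.
    exists (~` K i); last by move=> a b na _ /= /na.
    by apply: open_nbhs_nbhs; split => //; exact: closed_openC.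
  have ix := Kdom Kx.
  have nx : \forall y \near x, `|ph i x - ph i y| < rho / 2.
    by have /cvgrPdist_lt := cvg_chart ix; apply; rewrite divr_gt0.
  exists (dom i `&` [set y | `|ph i x - ph i y| < rho / 2]).
    by apply: filterI nx; exact: near_chart_dom.
  move=> a b [_ /= xa] [ib /= xb] _; split => //; rewrite [rho]splitr.
  by apply: le_lt_trans (ler_distD (ph i x) _ _) _; apply: ltrD => //; rewrite distrC.
by apply: vicinityS (vicinity_forall vi) => -[a b].
Qed.

Section OneMap.
Variables (r : nat) (f : M -> M).
Hypotheses (r_ge1 : (1 <= r)%N) (f_Cr : Cr_map r f).

Let f_cont : continuous f. Proof. by case: f_Cr. Qed.

(** Continuity of the differential in operator norm, from its continuity on each
    vector of the canonical basis. *)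
Lemma near_chart_diff (i j : I) x0 (e : R) : dom i x0 -> dom j (f x0) -> 0 < e ->
  \forall u \near ph i x0, [/\ (ph i @` dom i) u, dom j (f (ps i u)),
    differentiable (rep f i j) u &
    forall w, `|'d (rep f i j) u w - L f i j x0 w| <= e * `|w|].
Proof.
move=> ix jx e0; have [_ Ch] := f_Cr.
have [dF cF] := Ck_on_differentiable r_ge1 (Ch (atlas_chart i) (atlas_chart j)).
have ub (b : 'I_d) : \forall u \near ph i x0,
    `|'d (rep f i j) u (delta_mx ord0 b) - L f i j x0 (delta_mx ord0 b)| <= e / d.+1%:R.
  have Ux : ((chart (atlas_chart i)) @` (dom i `&` f @^-1` dom j)) (ph i x0) by exists x0.
  have /cvgrPdist_le := cF (delta_mx ord0 b) _ Ux.
  move=> /(_ (e / d.+1%:R)); rewrite divr_gt0// => /(_ isT).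
  by apply: filterS => u h; rewrite distrC; exact: h.
have {}ub := @filter_forall _ _ _ _ (nbhs_filter (ph i x0)) ub.
have h1 := near_chart_rep (h := f) (@f_cont x0) ix jx.
near=> u.
have uj : forall b : 'I_d,
    `|'d (rep f i j) u (delta_mx ord0 b) - L f i j x0 (delta_mx ord0 b)| <= e / d.+1%:R.
  by near: u.
have [iu iu' ku ju] : [/\ (ph i @` dom i) u, dom i (ps i u), ph i (ps i u) = u &
    dom j (f (ps i u))] by near: u.
split => //; first by apply: dF; exists (ps i u).
pose N := 'd (rep f i j) u \- L f i j x0.
have := @linear_rV_bound _ _ _ N e; apply; last exact: uj.
by exists ('d (rep f i j) u \- L f i j x0).
Unshelve. all: by end_near. Qed.

(** Strict differentiability, uniformly over the atlas: by [mean_value_ineq], since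
    the differential is almost constant on small balls. *)
Lemma near_strict_diff (e : R) : 0 < e -> \forall rho \near 0^'+,
  forall (i j : I) x, K i x -> K j (f x) ->
  (forall u v, `|ph i x - u| < rho -> `|ph i x - v| < rho ->
     [/\ (ph i @` dom i) u, dom j (f (ps i u)) &
        `|rep f i j u - rep f i j v - L f i j x (u - v)| <= e * `|u - v|]) /\
  (forall y, dom i y -> `|ph i x - ph i y| < rho ->
     forall w, `|L f i j y w - L f i j x w| <= e * `|w|).
Proof.
move=> e0; have e20 : 0 < e / 2 by rewrite divr_gt0.
apply: filter_forall => i; apply: filter_forall => j.
pose P (rho : R) x :=
  (forall u v, `|ph i x - u| < rho -> `|ph i x - v| < rho ->
     [/\ (ph i @` dom i) u, dom j (f (ps i u)) &
        `|rep f i j u - rep f i j v - L f i j x (u - v)| <= e * `|u - v|]) /\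
  (forall y, dom i y -> `|ph i x - ph i y| < rho ->
     forall w, `|L f i j y w - L f i j x w| <= e * `|w|).
have cK : compact (K i `&` f @^-1` K j).
  apply: compact_closedI; first exact: atlas_compact.
  by apply: preimage_closed (@Kclosed j) => x _; exact: f_cont.
move/compact_near_coveringP in cK.
have : \forall rho \near 0^'+, K i `&` f @^-1` K j `<=` P rho.
  apply: cK => x0 [/Kdom ix0 /Kdom jx0].
  have /nbhs_ballP[q /= q0 qP] := near_chart_diff ix0 jx0 e20.
  have q20 : 0 < q / 2 by rewrite divr_gt0.
  have nx : \forall x \near x0, `|ph i x0 - ph i x| < q / 2.
    by have /cvgrPdist_lt := cvg_chart ix0; apply.
  near=> x rho.
  have xq : `|ph i x0 - ph i x| < q / 2 by near: x.
  have ix : dom i x by near: x; exact: near_chart_dom.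
  have rhoq : rho < q / 2 by near: rho; exact: nbhs_right_lt.
  have inball u : `|ph i x - u| < rho -> ball (ph i x0) q u.
    move=> xu; rewrite -ball_normE /= [q]splitr.
    apply: le_lt_trans (ler_distD (ph i x) _ _) _; apply: ltrD => //.
    exact: lt_trans rhoq.
  have Lx w : `|L f i j x w - L f i j x0 w| <= e / 2 * `|w|.
    have bx : ball (ph i x0) q (ph i x).
      by rewrite -ball_normE /=; apply: lt_trans xq _; rewrite ltr_pdivrMr// ltr_pMr// ltr1n.
    by have [_ _ _] := qP _ bx; apply.
  split=> [u v xu xv|y iy xy w]; last first.
    have [_ _ _ Ly] := qP _ (inball _ xy).
    have -> : L f i j y w - L f i j x w =
      (L f i j y w - L f i j x0 w) - (L f i j x w - L f i j x0 w).
      by rewrite opprB addrA subrK.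
    apply: le_trans (ler_normB _ _) _; rewrite [e]splitr mulrDl.
    by apply: lerD; [exact: Ly|exact: Lx].
  have [iu ju _ _] := qP u (inball u xu).
  split => //.
  have seg (t : R) : 0 <= t <= 1 -> ball (ph i x0) q (v + t *: (u - v)).
    move=> /andP[t0 t1]; apply: inball.
    have -> : ph i x - (v + t *: (u - v)) =
        (1 - t) *: (ph i x - v) + t *: (ph i x - u).
      rewrite !scalerBr scalerBl !scale1r scalerBl scale1r.
      by apply/rowP => k; rewrite !mxE; ring.
    apply: le_lt_trans (ler_normD _ _) _; rewrite !normrZ (ger0_norm t0).
    rewrite ger0_norm ?subr_ge0//.
    set a := `|ph i x - v|; set b := `|ph i x - u|.
    apply: (@le_lt_trans _ _ (Num.max a b)); last by rewrite gt_max xv xu.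
    have ha : 0 <= (1 - t) * (Num.max a b - a).
      by rewrite mulr_ge0 ?subr_ge0// le_max lexx.
    have hb : 0 <= t * (Num.max a b - b).
      by rewrite mulr_ge0 ?subr_ge0// le_max lexx orbT.
    by move: ha hb; lra.
  have mv : `|rep f i j u - rep f i j v - L f i j x0 (u - v)| <= e / 2 * `|u - v|.
    apply: mean_value_ineq; first exact: ltW.
      by move=> t /seg/qP[].
    by move=> t /seg/qP[_ _ _]; apply.
  have -> : rep f i j u - rep f i j v - L f i j x (u - v) =
      (rep f i j u - rep f i j v - L f i j x0 (u - v)) -
      (L f i j x (u - v) - L f i j x0 (u - v)).
    by rewrite [X in _ = _ + X]opprB addrA subrK.
  apply: le_trans (ler_normB _ _) _; rewrite [e]splitr mulrDl.
  by apply: lerD => //; exact: Lx.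
by apply: filterS => rho KP x Kix Kjx; exact: (KP x (conj Kix Kjx)).
Unshelve. all: by end_near. Qed.

Lemma near_diff_bound : \forall l \near +oo_R,
  forall (i j : I) x, K i x -> K j (f x) -> forall w, `|L f i j x w| <= l * `|w|.
Proof.
apply: filter_forall => i; apply: filter_forall => j.
have cK : compact (K i `&` f @^-1` K j).
  apply: compact_closedI; first exact: atlas_compact.
  by apply: preimage_closed (@Kclosed j) => x _; exact: f_cont.
move/compact_near_coveringP in cK.
have : \forall l \near +oo_R, K i `&` f @^-1` K j `<=`
    [set x | forall w, `|L f i j x w| <= l * `|w|].
  apply: cK => x0 [/Kdom ix0 /Kdom jx0].
  have near1 : \forall x \near x0, forall w,
      `|L f i j x w - L f i j x0 w| <= 1 * `|w|.
    have := near_chart_diff ix0 jx0 ltr01 => /(near_chart ix0).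
    by apply: filterS => x [].
  pose C0 := d.+1%:R * \sum_j0 `|L f i j x0 (delta_mx ord0 j0)|.
  have C0P w : `|L f i j x0 w| <= C0 * `|w|.
    apply: (@linear_rV_bound _ _ _ (L f i j x0)); first by exists (L f i j x0).
    move=> b; rewrite /C0 mulrAC divff// mul1r (bigD1 b)//= lerDl; exact: sumr_ge0.
  near=> x l => w /=.
  have h1 : `|L f i j x w - L f i j x0 w| <= 1 * `|w| by move: w; near: x.
  have h2 : C0 + 1 <= l by near: l; apply: nbhs_pinfty_ge; exact: num_real.
  rewrite -[L f i j x w](subrK (L f i j x0 w)).
  apply: le_trans (ler_normD _ _) _; apply: le_trans (lerD h1 (C0P w)) _.
  by rewrite -mulrDl addrC ler_wpM2r.
by apply: filterS => l KP x Kix Kjx; exact: (KP x (conj Kix Kjx)).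
Unshelve. all: by end_near. Qed.

End OneMap.
End UniformEstimates.

(** * Comparison of the Riemannian norm with the norms of the charts *)

Lemma mx_inner_suml (R : realType) (d : nat) (G : 'M[R]_d) (I : finType) (c : I -> R)
    (x : I -> 'rV[R]_d) (v : 'rV[R]_d) :
  mx_inner G (\sum_i c i *: x i) v = \sum_i c i * mx_inner G (x i) v.
Proof.
rewrite /mx_inner mulmx_suml mulmx_suml summxE; apply: eq_bigr => i _.
by rewrite -!scalemxAl mxE.
Qed.

Lemma mx_inner_sumr (R : realType) (d : nat) (G : 'M[R]_d) (I : finType) (c : I -> R)
    (x : I -> 'rV[R]_d) (v : 'rV[R]_d) :
  mx_inner G v (\sum_i c i *: x i) = \sum_i c i * mx_inner G v (x i).
Proof.
rewrite /mx_inner linear_sum /= mulmx_sumr summxE; apply: eq_bigr => i _.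
by rewrite linearZ /= -scalemxAr mxE.
Qed.

Section NormComparison.
Variables (R : realType) (d : nat) (M : manifold R d) (A : finite_atlas M).
Variable g : riemannian_metric M.
Local Notation I := 'I_(atlas_size A).
Local Notation K := (@atlas_set _ _ _ A).

Let Q (i : chart_index M) (x : M) (u : 'rV[R]_d) : R :=
  mx_inner (metric_mx g x) (of_chart i x u) (of_chart i x u).

Let q (i : chart_index M) (a b : 'I_d) (x : M) : R :=
  mx_inner (metric_mx g x) (of_chart i x (delta_mx ord0 a)) (of_chart i x (delta_mx ord0 b)).

Let QE i x u : Q i x u = \sum_a \sum_b u ord0 a * (u ord0 b * q i a b x).
Proof.
have E : of_chart i x u =
    \sum_a u ord0 a *: (of_chart i x (delta_mx ord0 a) : 'rV[R]_d).
  exact: (linear_rV_expand (chart_diff id i (chart_at x) x) u).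
rewrite /Q E mx_inner_suml; apply: eq_bigr => a _.
by rewrite mx_inner_sumr mulr_sumr.
Qed.

Let q_continuous i a b x0 : chart_dom i x0 -> {for x0, continuous (q i a b)}.
Proof.
move=> ix0.
pose F p := q i a b (chart_inv i p).
have cF : {for chart i x0, continuous F}.
  by apply: (metric_smooth g i (delta_mx ord0 a) (delta_mx ord0 b) 0%N); exists x0.
have cFi : {for x0, continuous (F \o chart i)}.
  exact: continuous_comp (cvg_chart ix0) cF.
have E : q i a b x0 = F (chart i x0) by exact: congr1 (esym (chartK ix0)).
rewrite /prop_for /continuous_at E; apply: cvg_trans cFi.
apply: near_eq_cvg; apply: filterS (near_chart_dom ix0) => x ix.
exact: congr1 (chartK ix).
Qed.

Let Q_gt0 i x u : chart_dom i x -> u != 0 -> 0 < Q i x u.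
Proof.
move=> ix u0; apply: metric_pos; apply: contra u0 => /eqP E.
by rewrite -(of_chartK u ix) E to_chartE linear0.
Qed.

Let Q_continuous i x0 u0 : chart_dom i x0 ->
  Q i z.1 z.2 @[z --> (x0, u0)] --> Q i x0 u0.
Proof.
move=> ix0.
have -> : (fun z : M * 'rV[R]_d => Q i z.1 z.2) = fun z =>
    \sum_a \sum_b z.2 ord0 a * (z.2 ord0 b * q i a b z.1).
  by apply/funext => z; exact: QE.
rewrite QE; apply: (cvg_big (@add_continuous R)) => a _.
apply: (cvg_big (@add_continuous R)) => b _.
have cv (k : 'I_d) : (fun z : M * 'rV[R]_d => z.2 ord0 k) @ (x0, u0) --> u0 ord0 k.
  apply: (cvg_comp (fun z : M * 'rV[R]_d => z.2) (fun v : 'rV[R]_d => v ord0 k)).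
    exact: cvg_snd.
  exact: coord_continuous.
apply: cvgM; first exact: cv.
apply: cvgM; first exact: cv.
apply: (cvg_comp (fun z : M * 'rV[R]_d => z.1) (q i a b)); first exact: cvg_fst.
exact: q_continuous.
Qed.

(** The squared norm is continuous and positive on the compact set of the points of
    a piece of the atlas and the unit vectors; homogeneity gives the other vectors. *)
Lemma near_tnorm_chart : \forall C \near +oo_R, forall (i : I) (x : M), K i x ->
  forall v : tangent x, `|to_chart (atlas_chart i) v| <= C * tnorm g v /\
    tnorm g v <= C * `|to_chart (atlas_chart i) v|.
Proof.
apply: filter_forall => i.
pose S : set 'rV[R]_d := [set u | `|u| = 1].
have cS : compact S.
  apply: bounded_closed_compact.
    exists 1; split; first exact: num_real.
    by move=> b b1 u /= ->; exact: ltW.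
  rewrite (_ : S = (fun u : 'rV[R]_d => `|u|) @^-1` [set 1]); last by [].
  apply: preimage_closed; last exact: closed_eq.
  by move=> u _; exact: norm_continuous.
have /compact_near_coveringP cKS := compact_setX (@atlas_compact _ _ _ A i) cS.
have : \forall C \near +oo_R, (K i `*` S) `<=`
    [set z | C^-1 <= Q (atlas_chart i) z.1 z.2 <= C].
  apply: cKS => -[x0 u0] /= [Kx0 u01].
  have ix0 := atlas_sub Kx0.
  have u00 : u0 != 0 by rewrite -normr_eq0 u01 oner_neq0.
  set c := Q (atlas_chart i) x0 u0.
  have c0 : 0 < c by exact: Q_gt0.
  have /cvgrPdist_lt/(_ (c / 2)) := @Q_continuous _ _ u0 ix0.
  rewrite divr_gt0// => /(_ isT) nQ.
  near=> z C => /=.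
  have h1 : `|c - Q (atlas_chart i) z.1 z.2| < c / 2 by near: z; exact: nQ.
  have h2 : 2 * c <= C by near: C; apply: nbhs_pinfty_ge; exact: num_real.
  have h3 : 2 / c <= C by near: C; apply: nbhs_pinfty_ge; exact: num_real.
  have C0 : 0 < C by apply: lt_le_trans h2; rewrite mulr_gt0.
  have h4 : C^-1 <= c / 2.
    by rewrite -[c / 2]invrK lef_pV2 ?posrE ?invr_gt0 ?divr_gt0// invfM invrK mulrC.
  by move: h1; rewrite ltr_distlC => /andP[h5 h6]; apply/andP; split; lra.
have near1 : \forall C \near +oo_R, 1 <= C :> R.
  by apply: nbhs_pinfty_ge; exact: num_real.
move=> nQ; near=> C => x Kx v.
have C1 : 1 <= C by near: C.
have C0 : 0 < C by exact: lt_le_trans C1.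
have KQ : (K i `*` S) `<=` [set z | C^-1 <= Q (atlas_chart i) z.1 z.2 <= C].
  by near: C.
have ix := atlas_sub Kx.
set u := to_chart (atlas_chart i) v.
have vE : tnorm g v = Num.sqrt (Q (atlas_chart i) x u) by rewrite /Q /u to_chartK.
have QC : C^-1 * `|u| ^+ 2 <= Q (atlas_chart i) x u <= C * `|u| ^+ 2.
  have [->|u0] := eqVneq u 0.
    rewrite QE normr0 expr0n !mulr0 big1 ?lexx// => a _.
    by rewrite big1// => b _; rewrite mxE mul0r.
  have n0 : `|u| != 0 by rewrite normr_eq0.
  have Su : S (`|u|^-1 *: u) by rewrite /S /= normrZ normfV normr_id mulVf.
  have -> : Q (atlas_chart i) x u =
      Q (atlas_chart i) x (`|u|^-1 *: u) * `|u| ^+ 2.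
    rewrite !QE mulr_suml; apply: eq_bigr => a _; rewrite mulr_suml.
    by apply: eq_bigr => b _; rewrite !mxE; field.
  have /= /andP[h1 h2] := KQ (x, `|u|^-1 *: u) (conj Kx Su).
  by rewrite !ler_wpM2r ?exprn_ge0.
have /andP[Q1 Q2] := QC.
have Q0 : 0 <= Q (atlas_chart i) x u.
  by apply: le_trans Q1; rewrite mulr_ge0 ?invr_ge0 ?exprn_ge0 ?(ltW C0).
have CC : C <= C ^+ 2 by rewrite expr2 ler_peMr// ltW.
have sq (a b : R) : 0 <= a -> 0 <= b -> a ^+ 2 <= b ^+ 2 -> a <= b.
  by move=> a0 b0; rewrite ler_pXn2r.
rewrite vE; split; apply: sq; rewrite ?exprMn ?sqr_sqrtr ?mulr_ge0 ?sqrtr_ge0 ?(ltW C0)//.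
  apply: (@le_trans _ _ (C * Q (atlas_chart i) x u)); last by rewrite ler_wpM2r.
  by rewrite -ler_pdivrMl.
by apply: le_trans Q2 _; rewrite ler_wpM2r ?exprn_ge0.
Unshelve. all: by end_near. Qed.

End NormComparison.

(** * Hyperbolicity over a finite window *)

Lemma iter_continuous (T : topologicalType) (h : T -> T) n :
  continuous h -> continuous (iter n h).
Proof.
move=> ch; elim: n => [|n IH] x; first exact: cvg_id.
by apply: (@continuous_comp _ _ _ (iter n h) h); [exact: IH|exact: ch].
Qed.

Lemma near_pinfty_ge1_ex (R : realType) (P : R -> Prop) :
  (\forall x \near +oo, P x) -> exists x, 1 <= x /\ P x.
Proof.
have n1 : \forall x \near +oo_R, 1 <= x by apply: nbhs_pinfty_ge; exact: num_real.
by move=> nP; have [x [x1 Px]] := filter_ex (filterI n1 nP); exists x.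
Qed.

Lemma geometric_small (R : realType) (c lambda e : R) :
  0 <= c -> 0 < lambda < 1 -> 0 < e -> exists m : nat, c * lambda ^+ m <= e.
Proof.
move=> c0 /andP[l0 l1] e0.
have h : (c * lambda ^+ n)%R @[n --> \oo] --> c * 0.
  by apply: cvgM; [exact: cvg_cst|apply: cvg_expr; rewrite gtr0_norm].
move: h; rewrite mulr0 => /cvgrPdist_le/(_ e e0)[m _ H].
exists m; have := H m (leqnn m); rewrite sub0r normrN; apply: le_trans.
exact: ler_norm.
Qed.

Section Hyperbolicity.
Variables (R : realType) (d : nat) (M : manifold R d) (A : finite_atlas M).
Variables (g : riemannian_metric M) (r : nat) (f finv : M -> M) (Om : set M).
Hypotheses (r_ge1 : (1 <= r)%N) (f_diffeo : Cr_diffeo r f finv).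
Hypothesis Om_hyperbolic : hyperbolic g f finv Om.
Local Notation I := 'I_(atlas_size A).
Local Notation K := (@atlas_set _ _ _ A).
Local Notation L h i j := (chart_diff h (@atlas_chart _ _ _ A i) (@atlas_chart _ _ _ A j)).

Let f_Cr : Cr_map r f. Proof. by case: f_diffeo. Qed.

Lemma smooth_at_iter (h : M -> M) n x : Cr_map r h -> smooth_at (iter n h) x.
Proof.
move=> Ch; have ch : continuous h by case: Ch.
elim: n => [|n IH]; first exact: smooth_at_id.
apply: (@smooth_at_comp _ _ _ (iter n h) h) => //; first exact: iter_continuous.
  exact: ch.
exact: Cr_smooth_at r_ge1 Ch.
Qed.

Lemma tangent_map_iterS n x (v : tangent x) :
  tangent_map (iter n.+1 f) v = tangent_map f (tangent_map (iter n f) v).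
Proof.
have cf : continuous f by case: f_Cr.
have [_ E] := chart_diff_comp (x := x) (h := iter n f) (h' := f)
  (@iter_continuous _ f n cf x) (cf _) (chart_at_dom x) (chart_at_dom _) (chart_at_dom _)
  (@smooth_at_iter f n x f_Cr) (Cr_smooth_at r_ge1 f_Cr).
exact: E.
Qed.

(** Stated for norms, since the two vectors are tangent at the points [x] and
    [h' (h x)], which are equal but not convertible. *)
Lemma tnorm_tangent_map_cancel (h h' : M -> M) x (v : tangent x) :
  cancel h h' -> continuous h -> continuous h' -> smooth_at h x -> smooth_at h' (h x) ->
  tnorm g (tangent_map h' (tangent_map h v)) = tnorm g v.
Proof.
move=> hK ch ch' sh sh'.
have [_ E] := chart_diff_comp (x := x) (ch x) (ch' _) (chart_at_dom x) (chart_at_dom _)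
  (chart_at_dom (h' (h x))) sh sh'.
have hE : h' \o h = id by apply/funext => y; exact: hK.
have E' : tangent_map h' (tangent_map h v) =
    chart_diff (h' \o h) (chart_at x) (chart_at (h' (h x))) x v :> 'rV[R]_d.
  exact: esym (E v).
rewrite /tnorm E' hE hK; congr (Num.sqrt (mx_inner _ _ _)); exact: chart_diff_id (chart_at_dom x) v.
Qed.

Lemma chart_diff_iterS (i j k : chart_index M) n p :
  chart_dom i p -> chart_dom j (iter n f p) -> chart_dom k (iter n.+1 f p) ->
  chart_diff (iter n.+1 f) i k p =1
  chart_diff f j k (iter n f p) \o chart_diff (iter n f) i j p.
Proof.
have cf : continuous f by case: f_Cr.
move=> ip jp kp.
have [_ E] := chart_diff_comp (x := p) (h := iter n f) (h' := f)
  (@iter_continuous _ f n cf p) (cf _) ip jp kp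
  (@smooth_at_iter f n p f_Cr) (Cr_smooth_at r_ge1 f_Cr).
exact: E.
Qed.

(** An affine perturbation of the linearized dynamics departs from it over [n]
    steps by a multiple of the errors, the same for all orbits and charts. *)
Lemma perturbed_orbit_bound (l : R) n : 0 <= l ->
  (forall (i j : I) x, K i x -> K j (f x) -> forall w, `|L f i j x w| <= l * `|w|) ->
  exists2 C : R, 0 <= C & forall (p : M) (a : nat -> I) (w e : nat -> 'rV[R]_d) (nu : R),
    (forall j, (j <= n)%N -> K (a j) (iter j f p)) ->
    (forall j, (j < n)%N -> w j.+1 = L f (a j) (a j.+1) (iter j f p) (w j) + e j) ->
    (forall j, (j < n)%N -> `|e j| <= nu) -> 0 <= nu ->
    `|w n - L (iter n f) (a 0%N) (a n) p (w 0%N)| <= C * nu.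
Proof.
move=> l0 Ll; elim: n => [|n [C C0 IH]].
  exists 0 => // p a w e nu Ka _ _ _; rewrite mul0r.
  have k0 := atlas_sub (Ka 0%N (leqnn 0)).
  by rewrite (chart_diff_id k0) subrr normr0.
exists (l * C + 1); first by rewrite addr_ge0 ?mulr_ge0.
move=> p a w e nu Ka we eb nu0.
have k0 := atlas_sub (Ka 0%N (leq0n _)).
have kn := atlas_sub (Ka n (leqnSn _)).
have kn1 := atlas_sub (Ka n.+1 (leqnn _)).
pose Gw := L (iter n f) (a 0%N) (a n) p (w 0%N).
have -> : L (iter n.+1 f) (a 0%N) (a n.+1) p (w 0%N) =
    L f (a n) (a n.+1) (iter n f p) Gw.
  exact: chart_diff_iterS k0 kn kn1 (w 0%N).
rewrite (we n (ltnSn n)).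
have -> : L f (a n) (a n.+1) (iter n f p) (w n) + e n -
    L f (a n) (a n.+1) (iter n f p) Gw =
    L f (a n) (a n.+1) (iter n f p) (w n - Gw) + e n.
  by rewrite linearB addrAC.
apply: le_trans (ler_normD _ _) _; rewrite mulrDl mul1r; apply: lerD; last exact: eb.
apply: le_trans (Ll _ _ _ (Ka n (leqnSn _)) (Ka n.+1 (leqnn _)) _) _.
rewrite -mulrA ler_wpM2l//; apply: IH => //.
- by move=> j jn; apply: Ka; exact: leqW.
- by move=> j jn; apply: we; exact: leqW.
- by move=> j jn; apply: eb; exact: leqW.
Qed.

(** The heart of the proof.  In the middle of a long window, the stable part of a
    vector is the contracted image of a vector at the beginning, and its unstable
    part is expanded into a vector at the end; so the middle is dominated by the
    two ends.  The stable and unstable parts at the ends are bounded by the ends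
    themselves and by the parts in the middle, which in turn are small multiples of
    them; this replaces a bound on the projections of the splitting.  The
    comparison of norms costs a constant factor, absorbed by taking [m] large. *)
Lemma hyperbolic_window : exists (m : nat) (C : R), 0 <= C /\
  forall (p : M) (a : nat -> I) (w e : nat -> 'rV[R]_d) (mu nu : R), Om p ->
    (forall j, (j <= m + m)%N -> K (a j) (iter j f p)) ->
    (forall j, (j < m + m)%N -> w j.+1 = L f (a j) (a j.+1) (iter j f p) (w j) + e j) ->
    (forall j, (j < m + m)%N -> `|e j| <= nu) -> 0 <= nu ->
    `|w 0%N| <= mu -> `|w (m + m)%N| <= mu -> `|w m| <= 4^-1 * mu + C * nu.
Proof.
have [fK finvK _ finv_Cr] := f_diffeo.
have cf : continuous f by case: f_Cr.
have cfinv : continuous finv by case: finv_Cr.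
have [_ fOm [Es [Eu [split_ _ [invs invu] [c [lam [c0 lam01 hs hu]]]]]]] := Om_hyperbolic.
have Omi n p : Om p -> Om (iter n f p).
  by move=> Op; elim: n => //= n IH; rewrite -fOm; exists (iter n f p).
have inv_iter (E : M -> {vspace 'rV[R]_d}) n p (v : tangent p) :
    invariant_subbundle f Om E -> Om p -> v \in E p ->
    (tangent_map (iter n f) v : 'rV[R]_d) \in E (iter n f p).
  move=> invE Op vE; elim: n => [|n IH].
    by have -> : tangent_map (iter 0 f) v = v by exact: chart_diff_id (chart_at_dom p) v.
  rewrite tangent_map_iterS.
  have := invE _ (Omi n p Op) => /seteqP[+ _]; apply.
  by exists (tangent_map (iter n f) v).
have hu' n p (v : tangent p) : Om p -> v \in Eu p ->
    tnorm g v <= c * lam ^+ n * tnorm g (tangent_map (iter n f) v).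
  move=> Op vE; have := hu _ n _ (Omi n p Op) (inv_iter _ n _ _ invu Op vE).
  rewrite tnorm_tangent_map_cancel //; last exact: smooth_at_iter.
  - elim: n => [|n IH] x //; by rewrite iterSr /= fK IH.
  - exact: iter_continuous.
  - exact: iter_continuous.
  - exact: smooth_at_iter.
have [B [B1 BP]] : exists B : R, 1 <= B /\ forall (i : I) (x : M), K i x ->
  forall v : tangent x, `|to_chart (atlas_chart i) v| <= B * tnorm g v /\
    tnorm g v <= B * `|to_chart (atlas_chart i) v|.
  exact: near_pinfty_ge1_ex (near_tnorm_chart A g).
have [l [l1 lP]] : exists l : R, 1 <= l /\ forall (i j : I) x, K i x -> K j (f x) ->
    forall w, `|L f i j x w| <= l * `|w|.
  exact: near_pinfty_ge1_ex (near_diff_bound A r_ge1 f_Cr).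
have B0 : 0 <= B by exact: le_trans B1.
have l0 : 0 <= l by exact: le_trans l1.
have [m mP] : exists m, B * B * c * lam ^+ m <= 16^-1.
  by apply: geometric_small => //; rewrite ?mulr_ge0 ?(ltW c0)// invr_gt0.
(* From here on the contraction over [m] steps, charts included, is by 1/16. *)
have [C1 C10 C1P] := perturbed_orbit_bound m l0 lP.
have [C2 C20 C2P] := perturbed_orbit_bound (m + m) l0 lP.
exists m, (C1 + C2); split; first exact: addr_ge0.
move=> p a w e mu nu Op Ka we eb nu0 w0 w2.
have mm : (m <= m + m)%N by rewrite leq_addr.
have Op' := Omi m p Op; set p' := iter m f p in Op'.
have K0 := Ka 0%N (leq0n _); have Km := Ka m mm; have K2 := Ka _ (leqnn (m + m)).
have k0 := atlas_sub K0; have km := atlas_sub Km; have k2 := atlas_sub K2.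
have itm : iter (m + m) f = iter m f \o iter m f by apply/funext => x; rewrite iterD.
have K2' : K (a (m + m)%N) (iter m f p') by rewrite /p' -iterD.
have k2' := atlas_sub K2'.
have chain2 u : L (iter (m + m) f) (a 0%N) (a (m + m)%N) p u =
    L (iter m f) (a m) (a (m + m)%N) p' (L (iter m f) (a 0%N) (a m) p u).
  rewrite itm.
  have [_ E] := chart_diff_comp (x := p) (h := iter m f) (h' := iter m f)
    (@iter_continuous _ f m cf p) (@iter_continuous _ f m cf _) k0 km k2'
    (@smooth_at_iter f m p f_Cr) (@smooth_at_iter f m _ f_Cr).
  exact: E.
pose v0 : tangent p := of_chart (atlas_chart (a 0%N)) p (w 0%N).
have v0E : to_chart (atlas_chart (a 0%N)) v0 = w 0%N by exact: of_chartK.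
have [full _] := split_ p Op.
have : (v0 : 'rV[R]_d) \in (Es p + Eu p)%VS by rewrite full memvf.
move=> /memv_addP[vs vsE [vu vuE v0su]].
pose Ds : tangent p' := tangent_map (iter m f) (vs : tangent p).
pose Du : tangent p' := tangent_map (iter m f) (vu : tangent p).
have DsE : (Ds : 'rV[R]_d) \in Es p' by exact: inv_iter.
have DuE : (Du : 'rV[R]_d) \in Eu p' by exact: inv_iter.
have toM q (v : tangent q) i j : Om q -> K i q -> K j (iter m f q) ->
    to_chart (atlas_chart j) (tangent_map (iter m f) v) =
    L (iter m f) i j q (to_chart (atlas_chart i) v).
  move=> Oq Ki Kj; apply: to_chart_tangent_map; [exact: iter_continuous|exact: smooth_at_iter
    |exact: atlas_sub|exact: atlas_sub].
have stab q (v : tangent q) i j : Om q -> K i q -> K j (iter m f q) -> v \in Es q ->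
    `|L (iter m f) i j q (to_chart (atlas_chart i) v)| <=
    16^-1 * `|to_chart (atlas_chart i) v|.
  move=> Oq Ki Kj vE; rewrite -toM//.
  have [h1 _] := BP j _ Kj (tangent_map (iter m f) v); have [_ h2] := BP i q Ki v.
  have h3 := hs q m v Oq vE.
  apply: le_trans h1 _; apply: le_trans (ler_wpM2l B0 h3) _.
  have ct0 : 0 <= c * lam ^+ m.
    by rewrite mulr_ge0 ?exprn_ge0 ?(ltW c0)//; case/andP: lam01 => /ltW.
  apply: le_trans (ler_wpM2l B0 (ler_wpM2l ct0 h2)) _.
  by have := ler_wpM2r (normr_ge0 (to_chart (atlas_chart i) v)) mP; lra.
have unst q (v : tangent q) i j : Om q -> K i q -> K j (iter m f q) -> v \in Eu q ->
    `|to_chart (atlas_chart i) v| <=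
    16^-1 * `|L (iter m f) i j q (to_chart (atlas_chart i) v)|.
  move=> Oq Ki Kj vE; rewrite -toM//; set y := tangent_map (iter m f) v.
  have [_ h1] := BP j _ Kj y; have [h2 _] := BP i q Ki v.
  have h3 := hu' m q v Oq vE.
  apply: le_trans h2 _; apply: le_trans (ler_wpM2l B0 h3) _.
  have ct0 : 0 <= c * lam ^+ m.
    by rewrite mulr_ge0 ?exprn_ge0 ?(ltW c0)//; case/andP: lam01 => /ltW.
  apply: le_trans (ler_wpM2l B0 (ler_wpM2l ct0 h1)) _.
  by have := ler_wpM2r (normr_ge0 (to_chart (atlas_chart j) y)) mP; lra.
pose s := to_chart (atlas_chart (a 0%N)) (vs : tangent p).
pose u := to_chart (atlas_chart (a 0%N)) (vu : tangent p).
have w0su : w 0%N = s + u.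
  by rewrite -v0E v0su /s /u !to_chartE linearD.
pose S := L (iter m f) (a 0%N) (a m) p s; pose U := L (iter m f) (a 0%N) (a m) p u.
have SE : S = to_chart (atlas_chart (a m)) Ds by rewrite /S /s -toM.
have UE : U = to_chart (atlas_chart (a m)) Du by rewrite /U /u -toM.
pose S' := L (iter m f) (a m) (a (m + m)%N) p' S; pose U' := L (iter m f) (a m) (a (m + m)%N) p' U.
have hS : `|S| <= 16^-1 * `|s| by exact: stab.
have hu1 : `|u| <= 16^-1 * `|U| by exact: unst.
have hS' : `|S'| <= 16^-1 * `|S| by rewrite /S' SE; exact: stab.
have hU : `|U| <= 16^-1 * `|U'| by rewrite /U' UE; exact: unst.
have E1 : L (iter m f) (a 0%N) (a m) p (w 0%N) = S + U.
  by rewrite w0su; exact: linearD.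
have e1 : `|w m - (S + U)| <= C1 * nu.
  apply: (eq_ind _ (fun z => `|w m - z| <= C1 * nu) _ _ E1).
  exact: (C1P p a w e nu (fun j jm => Ka j (leq_trans jm mm))
    (fun j jm => we j (leq_trans jm mm)) (fun j jm => eb j (leq_trans jm mm)) nu0).
have e2 : `|w (m + m)%N - (S' + U')| <= C2 * nu.
  have E : L (iter (m + m) f) (a 0%N) (a (m + m)%N) p (w 0%N) = S' + U'.
    apply: etrans (chain2 (w 0%N)) _.
    apply: etrans (congr1 (L (iter m f) (a m) (a (m + m)%N) p') E1) _.
    exact: linearD.
  apply: (eq_ind _ (fun z => `|w (m + m)%N - z| <= C2 * nu) _ _ E).
  exact: (C2P p a w e nu Ka we eb nu0).
(* The remaining inequalities only involve norms of vectors. *)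
clear SE UE E1; clearbody S' U'; clearbody S U; clearbody s u.
have ws : `|s| <= mu + `|u|.
  have -> : s = w 0%N - u by rewrite w0su addrK.
  by apply: le_trans (ler_normB _ _) _; rewrite lerD2r.
have wU' : `|U'| <= mu + `|S'| + C2 * nu.
  have -> : U' = w (m + m)%N - S' - (w (m + m)%N - (S' + U')).
    by rewrite opprB [RHS]addrC addrA subrK addrAC subrr add0r.
  apply: le_trans (ler_normB _ _) _; apply: lerD => //.
  by apply: le_trans (ler_normB _ _) _; rewrite lerD2r.
have wm : `|w m| <= `|S| + `|U| + C1 * nu.
  rewrite -[w m](subrK (S + U)) addrC; apply: le_trans (ler_normD _ _) _.
  by apply: lerD => //; exact: ler_normD.
have mu0 : 0 <= mu by exact: le_trans w0.
have C2nu : 0 <= C2 * nu by exact: mulr_ge0.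
by rewrite mulrDl; lra.
Qed.

End Hyperbolicity.

(** * Pseudo-orbits near a hyperbolic set *)

Section HyperbolicSet.
Variables (R : realType) (d : nat) (M : manifold R d) (A : finite_atlas M).
Hypothesis M_compact : compact [set: M].
Variables (g : riemannian_metric M) (r : nat) (f finv : M -> M) (Om : set M).
Hypotheses (r_ge1 : (1 <= r)%N) (f_diffeo : Cr_diffeo r f finv).
Hypothesis Om_hyperbolic : hyperbolic g f finv Om.
Local Notation I := 'I_(atlas_size A).
Local Notation K := (@atlas_set _ _ _ A).
Local Notation ph i := (@chart _ _ M (atlas_chart i)).
Local Notation ps i := (@chart_inv _ _ M (atlas_chart i)).
Local Notation dom i := (@chart_dom _ _ M (@atlas_chart _ _ _ A i)).
Local Notation rep h i j := (chart_rep h (@atlas_chart _ _ _ A i) (@atlas_chart _ _ _ A j)).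
Local Notation L h i j := (chart_diff h (@atlas_chart _ _ _ A i) (@atlas_chart _ _ _ A j)).

Let f_Cr : Cr_map r f. Proof. by case: f_diffeo. Qed.
Let f_cont : continuous f. Proof. by case: f_Cr. Qed.

Lemma chart_choice : exists (c : M -> I) (E : set (M * M)), vicinity E /\
  forall x y, E (x, y) -> K (c x) y.
Proof.
have [i0 i0P] := choice (@atlas_nbhs _ _ _ A).
have [E vE EP] := vicinity_Lebesgue (@points_hausdorff _ _ M) M_compact i0P.
have /choice[p pP] := EP.
by exists (fun x => i0 (p x)), E; split => // x y; exact: pP.
Qed.

(* The data provided by [chart_choice]. *)
Variables (c : M -> I) (EL : set (M * M)).
Hypotheses (vEL : vicinity EL) (cEL : forall x y, EL (x, y) -> K (c x) y).

Let Kc x : K (c x) x. Proof. exact: cEL (vicinity_refl x vEL). Qed.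

(** The estimate of [hyperbolic_window] passes to fine pseudo-orbits: over a window of
    fixed length they stay close to the orbit of their first point, so the
    differentials along both differ by little.  The splitting enters along true
    orbits only. *)
Lemma pseudo_orbit_estimate : exists (m : nat) (C : R), 0 <= C /\
  exists2 D, vicinity D &
  forall (x : nat -> M) (w e : nat -> 'rV[R]_d) (mu nu : R), Om (x 0%N) ->
    (forall j, (j < m + m)%N -> D (f (x j), x j.+1)) ->
    (forall j, (j < m + m)%N -> w j.+1 = L f (c (x j)) (c (x j.+1)) (x j) (w j) + e j) ->
    (forall j, (j < m + m)%N -> `|e j| <= nu) -> 0 <= nu ->
    (forall j, (j <= m + m)%N -> `|w j| <= mu) ->
    `|w m| <= 2^-1 * mu + C * nu.
Proof.
have [m [C [C0 HW]]] := hyperbolic_window A r_ge1 f_diffeo Om_hyperbolic.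
exists m, C; split => //.
pose eta := (4 * (C + 1))^-1.
have eta0 : 0 < eta by rewrite invr_gt0 mulr_gt0// ltr_wpDl.
have [rho [rho0 rhoP]] : exists rho : R, 0 < rho /\ forall (i j : I) x, K i x -> K j (f x) ->
    forall y, dom i y -> `|ph i x - ph i y| < rho ->
    forall w, `|L f i j y w - L f i j x w| <= eta * `|w|.
  have n0 : \forall rho \near (0 : R)^'+, 0 < rho by exact: nbhs_right_gt.
  have [rho [h1 h2]] := filter_ex (filterI n0 (near_strict_diff A r_ge1 f_Cr eta0)).
  by exists rho; split => // i j x Ki Kj; have [] := h2 i j x Ki Kj.
pose E := [set ab : M * M | EL (ab.2, ab.1)] `&` [set ab | forall i : I, K i ab.2 ->
  dom i ab.1 /\ `|ph i ab.2 - ph i ab.1| < rho].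
have vE : vicinity E.
  apply: vicinityI; first exact: (vicinity_swap vEL).
  exact: (vicinity_swap (vicinity_coord A rho0)).
have [D vD DP] := vicinity_pseudo_orbit (@points_hausdorff _ _ M) M_compact (m + m) f_cont vE.
exists D => // x w e mu nu Ox xD we eb nu0 wb.
have xE := DP x xD.
have Kit j : (j <= m + m)%N -> K (c (x j)) (iter j f (x 0%N)).
  by move=> jm; have [h _] := xE j jm; exact: cEL h.
pose e' j : 'rV[R]_d := w j.+1 - L f (c (x j)) (c (x j.+1)) (iter j f (x 0%N)) (w j).
have mu0 : 0 <= mu by exact: le_trans (wb 0%N _).
have nu'0 : 0 <= nu + eta * mu by rewrite addr_ge0 ?mulr_ge0 ?(ltW eta0).
have e'b j : (j < m + m)%N -> `|e' j| <= nu + eta * mu.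
  move=> jm; rewrite /e' (we j jm).
  have [_ hx] := xE j (ltnW jm); have [/= dx cx] := hx _ (Kc (x j)).
  have Ly := rhoP _ _ _ (Kit j (ltnW jm)) (Kit j.+1 jm).
  have := Ly (x j) (atlas_sub (Kc (x j))).
  rewrite distrC => /(_ cx (w j)) h.
  rewrite addrAC addrC; apply: le_trans (ler_normD _ _) _; apply: lerD; first exact: eb.
  apply: le_trans h _; rewrite ler_wpM2l ?(ltW eta0)//; exact: wb (ltnW jm).
have w'e j : (j < m + m)%N ->
    w j.+1 = L f (c (x j)) (c (x j.+1)) (iter j f (x 0%N)) (w j) + e' j.
  by move=> _; rewrite /e' addrC subrK.
have := HW (x 0%N) (fun j => c (x j)) w e' mu (nu + eta * mu) Ox Kit w'e e'b nu'0
  (wb 0%N (leq0n _)) (wb _ (leqnn _)).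
move/le_trans; apply.
have Ceta : C * eta <= 4^-1.
  rewrite /eta invfM mulrCA ler_piMr// ler_pdivrMr ?mul1r ?lerDl//.
  by rewrite ltr_wpDl.
by have := ler_wpM2r mu0 Ceta; lra.
Qed.

(** The difference of two close orbits, in charts, satisfies the linearized
    recursion up to errors proportional to itself.  By the estimate its size in
    the middle of each window is at most 3/4 of its maximum over the window;
    iterating from the window [0, 2N] towards its centre gives the decay. *)
Lemma hyperbolic_expansive : expansive f Om.
Proof.
have Omf x : Om x -> Om (f x).
  by move=> Ox; have [_ h _] := Om_hyperbolic; rewrite -h; exists x.
have [m [C [C0 [D vD est]]]] := pseudo_orbit_estimate.
pose eta := (4 * (C + 1))^-1.
have eta0 : 0 < eta by rewrite invr_gt0 mulr_gt0// ltr_wpDl.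
have [rho [rho0 rhoP]] : exists rho : R, 0 < rho /\ forall (i j : I) x, K i x -> K j (f x) ->
   forall u v, `|ph i x - u| < rho -> `|ph i x - v| < rho ->
     [/\ (ph i @` dom i) u, dom j (f (ps i u)) &
        `|rep f i j u - rep f i j v - L f i j x (u - v)| <= eta * `|u - v|].
  have n0 : \forall rho \near (0 : R)^'+, 0 < rho by exact: nbhs_right_gt.
  have [rho [h1 h2]] := filter_ex (filterI n0 (near_strict_diff A r_ge1 f_Cr eta0)).
  by exists rho; split => // i j x Ki Kj; have [] := h2 i j x Ki Kj.
exists [set xy | forall i : I, K i xy.1 -> dom i xy.2 /\ `|ph i xy.1 - ph i xy.2| < rho].
  exact: vicinity_coord.
move=> E vE.
have [rho1 [rho10 rho1E]] : exists rho1 : R, 0 < rho1 /\ forall (i : I) x y,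
    K i x -> dom i y -> `|ph i x - ph i y| < rho1 -> E (x, y).
  have n0 : \forall rho \near (0 : R)^'+, 0 < rho by exact: nbhs_right_gt.
  have [rho1 [h1 h2]] := filter_ex (filterI n0 (near_coord_vicinity A vE)).
  by exists rho1.
have [k kP] : exists k : nat, rho * (3 / 4 : R) ^+ k <= rho1 / 2.
  apply: geometric_small; rewrite ?(ltW rho0) ?divr_gt0//; apply/andP; split; lra.
exists (k * m)%N => x y Ox Oy xy.
have Oi i : Om (iter i f x) by elim: i => //= i IH; exact: Omf.
pose X i := iter i f x; pose Y i := iter i f y.
pose w i : 'rV[R]_d := ph (c (X i)) (Y i) - ph (c (X i)) (X i).
have XY i : (i <= (k * m).*2)%N -> dom (c (X i)) (Y i) /\ `|w i| < rho.
  move=> ik; have [h1 h2] := xy i ik (c (X i)) (Kc _); split => //.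
  by rewrite /w distrC.
pose e i : 'rV[R]_d := w i.+1 - L f (c (X i)) (c (X i.+1)) (X i) (w i).
have eb i : (i < (k * m).*2)%N -> `|e i| <= eta * `|w i|.
  move=> ik; have [dY wr] := XY i (ltnW ik).
  have KfX : K (c (X i.+1)) (f (X i)) by exact: (Kc (X i.+1)).
  have := rhoP _ _ _ (Kc (X i)) KfX (ph (c (X i)) (Y i)) (ph (c (X i)) (X i)).
  rewrite distrC subrr normr0 => /(_ wr rho0)[_ _].
  have dX := atlas_sub (Kc (X i)).
  by rewrite /chart_rep /= (chartK dY) (chartK dX).
have step t : (t <= k)%N -> forall i, (t * m <= i)%N -> (i + t * m <= (k * m).*2)%N ->
    `|w i| <= rho * (3 / 4) ^+ t.
  elim: t => [|t IH] tk i; first by rewrite mul0n addn0 expr0 mulr1 => _ /XY[_ /ltW].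
  rewrite mulSn => ti ik.
  have mi : (m <= i)%N by apply: leq_trans ti; exact: leq_addr.
  set b := rho * (3 / 4) ^+ t.
  have b0 : 0 <= b by rewrite mulr_ge0 ?exprn_ge0 ?(ltW rho0)//; lra.
  have wb j : (j <= m + m)%N -> `|w (i - m + j)%N| <= b.
    move=> jm; apply: IH; first exact: ltnW.
      by apply: leq_trans (leq_addr _ _); rewrite leq_subRL ?(leq_trans (leq_addr _ _) ti).
    apply: leq_trans ik; rewrite addnA leq_add2r.
    by rewrite -{2}(subnK mi) -addnA leq_add2l.
  have iD j : (j < m + m)%N -> (i - m + j < (k * m).*2)%N.
    move=> jm; apply: leq_trans ik; rewrite -{2}(subnK mi) -!addnA ltn_add2l.
    by apply: leq_trans jm _; rewrite leq_add2l leq_addr.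
  have := est (fun j => X (i - m + j)%N) (fun j => w (i - m + j)%N)
    (fun j => e (i - m + j)%N) b (eta * b).
  rewrite subnK// => H.
  have Ceta : C * eta <= 4^-1.
    rewrite /eta invfM mulrCA ler_piMr// ler_pdivrMr ?mul1r ?lerDl//.
    by rewrite ltr_wpDl.
  apply: le_trans (H _ _ _ _ _ _) _.
  - exact: Oi.
  - by move=> j _; rewrite addnS; exact: vicinity_refl.
  - by move=> j _; rewrite addnS /e addrC subrK.
  - move=> j jm; apply: le_trans (eb _ (iD j jm)) _.
    by rewrite ler_wpM2l ?(ltW eta0)//; exact: wb (ltnW jm).
  - by rewrite mulr_ge0 ?(ltW eta0).
  - exact: wb.
  have -> : rho * (3 / 4) ^+ t.+1 = 3 / 4 * b by rewrite /b exprS mulrCA.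
  clearbody b; by have := ler_wpM2r b0 Ceta; lra.
have := step k (leqnn k) (k * m)%N (leqnn _); rewrite addnn leqnn => /(_ isT) wN.
have [dY _] := XY (k * m)%N (leq_trans (leq_addr _ _) (eq_leq (addnn _))).
apply: (rho1E (c (X (k * m)%N)) _ _ (Kc _) dY).
rewrite distrC; apply: le_lt_trans (le_trans wN kP) _.
by rewrite ltr_pdivrMr// ltr_pMr// ltr1n.
Qed.

(** An orbit near a periodic pseudo-orbit [x] is, in charts centred at the points of
    [x], a small solution of an almost linear periodic recursion; and
    [pseudo_orbit_estimate] is the a priori estimate on which
    [periodic_recursion_solution] rests. *)
Lemma hyperbolic_shadowing : shadowing f Om.
Proof.
move=> E vE.
have [m [C [C0 [D0 vD0 est]]]] := pseudo_orbit_estimate.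
pose eta := (4 * (C + 1))^-1.
have C10 : 0 < C + 1 by rewrite ltr_wpDl.
have eta0 : 0 < eta by rewrite invr_gt0 mulr_gt0.
have Ceta : C * eta <= 4^-1.
  by rewrite /eta invfM mulrCA ler_piMr// ler_pdivrMr ?mul1r ?lerDl.
have [rho [rho0 [rhoE rhoP]]] : exists rho : R, 0 < rho /\
    (forall (i : I) x y, K i x -> dom i y -> `|ph i x - ph i y| < rho -> E (x, y)) /\
    forall (i j : I) x, K i x -> K j (f x) ->
    forall u v, `|ph i x - u| < rho -> `|ph i x - v| < rho ->
     [/\ (ph i @` dom i) u, dom j (f (ps i u)) &
        `|rep f i j u - rep f i j v - L f i j x (u - v)| <= eta * `|u - v|].
  have n0 : \forall rho \near (0 : R)^'+, 0 < rho by exact: nbhs_right_gt.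
  have [rho [h1 [h2 h3]]] := filter_ex (filterI n0 (filterI (near_coord_vicinity A vE)
    (near_strict_diff A r_ge1 f_Cr eta0))).
  by exists rho; split => //; split => // i j x Ki Kj; have [] := h3 i j x Ki Kj.
have rho20 : 0 < rho / 2 by rewrite divr_gt0.
have rho2 : rho / 2 < rho by rewrite ltr_pdivrMr// ltr_pMr// ltr1n.
pose delta := rho / 2 * eta.
have delta0 : 0 < delta by exact: mulr_gt0.
exists (D0 `&` ([set ab | EL (ab.2, ab.1)] `&` [set ab : M * M | forall i : I, K i ab.2 ->
  dom i ab.1 /\ `|ph i ab.2 - ph i ab.1| < delta])).
  apply: vicinityI => //; apply: vicinityI; first exact: (vicinity_swap vEL).
  exact: (vicinity_swap (vicinity_coord A delta0)).
move=> n x n0 Ox xn xD.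
pose a i := c (x i); pose q i := ph (a i) (x i).
pose B i := L f (a i) (a i.+1) (x i).
pose G i v : 'rV[R]_d := rep f (a i) (a i.+1) (q i + v) - q i.+1.
have Ka i : K (a i) (x i) by exact: Kc.
have Kaf i : K (a i.+1) (f (x i)) by have [_ [h _]] := xD i; exact: cEL h.
have strict i u v : `|u| <= rho / 2 -> `|v| <= rho / 2 ->
    [/\ (ph (a i) @` dom (a i)) (q i + u), dom (a i.+1) (f (ps (a i) (q i + u))) &
      `|G i u - G i v - B i (u - v)| <= eta * `|u - v|].
  move=> ur vr.
  have near_q (z : 'rV[R]_d) : `|z| <= rho / 2 -> `|ph (a i) (x i) - (q i + z)| < rho.
    by move=> zr; rewrite opprD addrA subrr add0r normrN; exact: le_lt_trans zr rho2.
  have [h1 h2 h3] := rhoP _ _ _ (Ka i) (Kaf i) _ _ (near_q u ur) (near_q v vr).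
  split => //; move: h3.
  have -> : (q i + u) - (q i + v) = u - v by rewrite opprD addrACA subrr add0r.
  have -> // : G i u - G i v =
    rep f (a i) (a i.+1) (q i + u) - rep f (a i) (a i.+1) (q i + v).
  by rewrite /G opprB addrA subrK.
have [||||||||||w [wn wrho wG]] := @periodic_recursion_solution R n d m B G C eta delta (rho / 2) n0.
- by move=> i v; rewrite /B /a -addSn !xn.
- by move=> i v; rewrite /G /q /a -addSn !xn.
- exact: C0.
- exact: rho20.
- move=> w e mu nu we wmu enu nu0 i.
  apply: (est (fun j => x (i + j)%N) (fun j => w (i + j)%N) (fun j => e (i + j)%N)).
  + exact: Ox.
  + by move=> j _; rewrite addnS; have [] := xD (i + j)%N.
  + by move=> j _; rewrite addnS; exact: we.
  + by move=> j _; exact: enu.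
  + exact: nu0.
  + by move=> j _; exact: wmu.
- by move=> i u v ur vr; have [] := strict i u v ur vr.
- move=> i; have [_ [_ h]] := xD i; have [_ /= hd] := h _ (Ka i.+1).
  have -> : G i 0 = ph (a i.+1) (f (x i)) - ph (a i.+1) (x i.+1).
    by rewrite /G addr0 /chart_rep /= chartK//; exact: atlas_sub (Ka i).
  by rewrite distrC; exact: ltW hd.
- exact: ltW.
- by move: Ceta; lra.
- have := ler_wpM2r (ltW rho20) Ceta; rewrite /delta; lra.
pose y i := ps (a i) (q i + w i).
have zero_small : `|0 : 'rV[R]_d| <= rho / 2 by rewrite normr0 ltW.
have codw i : (ph (a i) @` dom (a i)) (q i + w i).
  by have [] := strict i (w i) 0 (wrho i) zero_small.
have yS i : f (y i) = y i.+1.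
  have [_ dS _] := strict i (w i) 0 (wrho i) zero_small.
  rewrite /y wG /G [q i.+1 + _]addrC subrK /chart_rep /= chartK//.
have yiter i : iter i f (y 0%N) = y i by elim: i => //= i ->; exact: yS.
exists (y 0%N).
  by rewrite yiter /y /q /a -[n]add0n xn wn.
move=> i; rewrite yiter; have [dy qy] := chart_codK (codw i).
apply: (rhoE (a i)) => //; rewrite /y qy opprD addrA subrr add0r normrN.
exact: le_lt_trans (wrho i) rho2.
Qed.

End HyperbolicSet.

(** * The spectral decomposition *)

Theorem theorem6p1 (R : realType) (d : nat) (M : manifold R d)
    (g : riemannian_metric M) (M_compact : compact [set: M])
    (r : nat) (r_ge1 : (1 <= r)%N) (f finv : M -> M)
    (f_diffeo : Cr_diffeo r f finv) (f_axiomA : axiomA g f finv) :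
  exists (s : nat) (Om : 'I_s -> set M),
    spectral_decomposition f Om /\
    forall (s' : nat) (Om' : 'I_s' -> set M),
      spectral_decomposition f Om' ->
      exists2 sigma : 'I_s' -> 'I_s,
        bijective sigma & forall i, Om' i = Om (sigma i).
Proof.
have [hyp dense_periodic] := f_axiomA.
have [Om_compact f_Om _] := hyp.
have [_ _ [f_cont _] _] := f_diffeo.
have [A] := finite_atlas_exists M_compact.
have [c [E [vE cE]]] := chart_choice A M_compact.
have shad := hyperbolic_shadowing M_compact r_ge1 f_diffeo hyp vE cE.
have expa := hyperbolic_expansive M_compact r_ge1 f_diffeo hyp vE cE.
have [s [Om dOm]] := spectral_decomposition_exists (@points_hausdorff _ _ M) f_cont
  Om_compact f_Om dense_periodic shad expa.
exists s, Om; split => // s' Om' dOm'.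
exact: spectral_decomposition_uniq dOm dOm'.
Qed.
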